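(* Let $\Phi=\Phi_++\Phi_-$ with $\Phi_+\in\mathcal{C}^2(\mathbb{R})$ convex and $\Phi_-\in\mathcal{C}^2(\mathbb{R})$ concave. Given $c_h^{n-1}\in S_h$, for any $\tau>0$ and any $h>0$ there exists a unique pair $(\boldsymbol{c}_h^n,\boldsymbol{\mu}_h^n)\in\boldsymbol{S}_h\times\boldsymbol{S}_h$, with $\boldsymbol{c}_h^n=(c_h^n,\hat c_h^n)$ and $\boldsymbol{\mu}_h^n=(\mu_h^n,\hat\mu_h^n)$, such that $$\Big(\frac{c_h^n-c_h^{n-1}}{\tau},\chi_h\Big)_\Omega+a_{\mathcal{D}}(\boldsymbol{\mu}_h^n,\boldsymbol{\chi}_h)=0,\qquad\forall\,\boldsymbol{\chi}_h=(\chi_h,\hat\chi_h)\in\boldsymbol{S}_h,$$ $$(\Phi_+'(c_h^n)+\Phi_-'(c_h^{n-1}),\phi_h)_\Omega+\kappa\,a_{\mathcal{D}}(\boldsymbol{c}_h^n,\boldsymbol{\phi}_h)=(\mu_h^n,\phi_h)_\Omega,\qquad\forall\,\boldsymbol{\phi}_h=(\phi_h,\hat\phi_h)\in\boldsymbol{S}_h.$$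
   Context: Let $d\in\{2,3\}$ and let $\Omega\subset\mathbb{R}^d$ be a bounded open polygonal ($d=2$) or polyhedral ($d=3$) domain. $\{\mathcal{E}_h\}_{h>0}$ is a family of conforming, shape-regular, quasi-uniform meshes of $\Omega$ made of simplices $E$ with boundary $\partial E$, outward unit normal $\mathbf{n}_E$ and diameter $h_E$; $h=\max_E h_E$. $\Gamma_h$ is the set of all (interior and boundary) faces of the mesh. Fix an integer $k\ge1$, and let $\mathbb{P}_k$ denote polynomials of degree at most $k$. Set $S_h=\{v\in L^2(\Omega): v|_E\in\mathbb{P}_k(E)\ \forall E\in\mathcal{E}_h\}$, $\hat S_h=\{v\in L^2(\Gamma_h): v|_e\in\mathbb{P}_k(e)\ \forall e\in\Gamma_h\}$, $\boldsymbol{S}_h=S_h\times\hat S_h$. Elements of product spaces are written in boldface, e.g. $\boldsymbol{v}_h=(v_h,\hat v_h)$. $(\cdot,\cdot)_\Omega$ is the $L^2(\Omega)$ inner product and $\kappa>0$ is a fixed parameter. The bilinear form is $$a_{\mathcal{D}}(\boldsymbol{u},\boldsymbol{v})=\sum_{E}\int_E\nabla u\cdot\nabla v\,dx-\sum_E\int_{\partial E}\big(\nabla u\cdot\mathbf{n}_E(v-\hat v)+(u-\hat u)\nabla v\cdot\mathbf{n}_E\big)ds+\sum_E\frac{\sigma}{h_E}\int_{\partial E}(u-\hat u)(v-\hat v)\,ds.$$ With $\|\boldsymbol{v}\|_{1,h}^2=\sum_E\|\nabla v\|_{L^2(E)}^2+\sum_E h_E^{-1}\|v-\hat v\|_{L^2(\partial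 E)}^2$, the penalty parameter $\sigma>0$ is fixed sufficiently large that $a_{\mathcal{D}}(\boldsymbol{v}_h,\boldsymbol{v}_h)\ge C_{\mathrm{coer}}\|\boldsymbol{v}_h\|_{1,h}^2$ for all $\boldsymbol{v}_h\in\boldsymbol{S}_h$, with $C_{\mathrm{coer}}>0$ independent of $h$. *)

(* Defs.v *)
From HB Require Import structures.
From mathcomp Require Import all_boot all_order all_algebra.
From mathcomp Require Import all_classical all_reals all_analysis.
(* Only canonical structures: the notations clash with MathComp-Analysis. *)
From mathcomp.multinomials Require mpoly.
Import (canonicals, coercions) mpoly.

Set Implicit Arguments.
Unset Strict Implicit.
Unset Printing Implicit Defensive.

Import Order.TTheory GRing.Theory Num.Theory.
Import numFieldNormedType.Exports.

Local Open Scope classical_set_scope.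
Local Open Scope ring_scope.

Section Euclidean.
Context {R : realType} {d : nat}.
Implicit Types (x y : 'rV[R]_d) (A : set 'rV[R]_d).

Definition edot x y : R := \sum_i x 0 i * y 0 i.

(* The library's norm on ['rV_d] is the sup norm; lengths are Euclidean. *)
Definition enorm x : R := Num.sqrt (edot x x).

Definition diam A : R := sup [set enorm (x - y) | x in A & y in A].

Definition inradius A : R :=
  sup [set r | 0 <= r /\ exists x, [set y | enorm (y - x) <= r] `<=` A].

Definition partial (i : 'I_d) (v : 'rV[R]_d -> R) x : R :=
  'D_(delta_mx 0 i) v x.

(* Limit of [v] at [x] along [A]: the trace from [A] at the points of the
   boundary of [A]. *)
Definition trace_from A (v : 'rV[R]_d -> R) x : R :=
  lim (v y @[y --> within A (nbhs x)]).

(* Polynomial functions of total degree at most [k] ([msize] is degree + 1). *)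
Definition polyfun (k : nat) (p : 'rV[R]_d -> R) : Prop :=
  exists2 q : mpoly.mpoly d R, (mpoly.msize q <= k.+1)%N
    & forall x, p x = mpoly.meval (fun i => x 0 i) q.

End Euclidean.

Section Simplices.
Context {R : realType} {d : nat} {I : finType}.
Variable p : I -> 'rV[R]_d.
Implicit Type F : {set I}.

Definition affinely_independent F : Prop :=
  forall l : I -> R, \sum_(i in F) l i = 0 ->
    \sum_(i in F) l i *: p i = 0 -> forall i, i \in F -> l i = 0.

Definition csimplex F : set 'rV[R]_d :=
  [set x | exists l : I -> R, [/\ forall i, i \in F -> 0 <= l i,
     \sum_(i in F) l i = 1 & x = \sum_(i in F) l i *: p i]].

(* Relative interior of [csimplex F]. *)
Definition osimplex F : set 'rV[R]_d :=
  [set x | exists l : I -> R, [/\ forall i, i \in F -> 0 < l i,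
     \sum_(i in F) l i = 1 & x = \sum_(i in F) l i *: p i]].

End Simplices.

Section Integration.
Context {R : realType}.
Local Notation leb := (@lebesgue_measure R).

Definition vec n (s : seq R) : 'rV[R]_n := \row_(i < n) s`_i.

(* Integral over [A] for the Lebesgue measure of R^n, i.e. the product of n
   copies of the Lebesgue measure of R. Only n = 1, 2, 3 occur below; the value
   0 for other n is a dummy. *)
Definition lebint n (A : set 'rV[R]_n) (f : 'rV[R]_n -> R) : R :=
  match n with
  | 1 => \int[leb]_(x in [set x | A (vec n [:: x])]) f (vec n [:: x])
  | 2 => \int[(leb \x leb)%E]_(z in [set z | A (vec n [:: z.1; z.2])])
           f (vec n [:: z.1; z.2])
  | 3 => \int[((leb \x leb) \x leb)%E]_(z in
             [set z | A (vec n [:: z.1.1; z.1.2; z.2])])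
           f (vec n [:: z.1.1; z.1.2; z.2])
  | _ => 0
  end.

Definition ref_simplex n : set 'rV[R]_n :=
  [set t | (forall i, 0 < t 0 i) /\ \sum_i t 0 i < 1].

(* Surface integral of [f] over the (d-1)-simplex with vertices [p i], [i] in
   [F], where #|F| = d: with q_0, ..., q_(d-1) the vertices and B the matrix of
   rows q_(j+1) - q_0, the affine parametrization t |-> q_0 + t B of the face by
   the reference simplex has area element sqrt (det (B B^T)). *)
Definition surfint d (I : finType) (p : I -> 'rV[R]_d) (F : {set I})
    (f : 'rV[R]_d -> R) : R :=
  let q := nth 0 [seq p i | i <- enum F] in
  let B : 'M[R]_(d.-1, d) := \matrix_(j, i) (q j.+1 - q 0) 0 i in
  Num.sqrt (\det (B *m B^T)) *
    lebint (@ref_simplex d.-1) (fun t => f (q 0%N + t *m B)).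

End Integration.

Section Domains.
Context {R : realType} {d : nat}.

(* The boundary is a finite union of nondegenerate (d-1)-simplices: segments
   when d = 2, triangles when d = 3. *)
Definition polyhedral_domain (Omega : set 'rV[R]_d) : Prop :=
  [/\ open Omega, connected Omega, Omega !=set0, bounded_set Omega
    & exists (N : nat) (q : 'I_N -> 'I_d -> 'rV[R]_d),
        (forall n, affinely_independent (q n) [set: 'I_d]%SET) /\
        closure Omega `\` Omega =
          \bigcup_(n in [set: 'I_N]) csimplex (q n) [set: 'I_d]%SET].

End Domains.

(* A finite simplicial mesh; elements and faces are given by their sets of
   vertices. *)
Record mesh (R : realType) (d : nat) := Mesh {
  nnodes : nat;
  node : 'I_nnodes -> 'rV[R]_d;
  elts : {set {set 'I_nnodes}}
}.

Section Meshes.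
Context {R : realType} {d : nat}.
Implicit Types (T : mesh R d) (Omega : set 'rV[R]_d).

Definition celt T (K : {set 'I_(nnodes T)}) := csimplex (@node R d T) K.
Definition oelt T (K : {set 'I_(nnodes T)}) := osimplex (@node R d T) K.

Definition conforming_mesh Omega T : Prop :=
  [/\ forall K, K \in elts T ->
        #|K| = d.+1 /\ affinely_independent (@node R d T) K,
      closure Omega = \bigcup_(K in [set K | K \in elts T]) celt K,
      forall K, K \in elts T -> oelt K `<=` Omega
    & forall K L, K \in elts T -> L \in elts T ->
        celt K `&` celt L = celt (K :&: L)%SET].

Definition hE T (K : {set 'I_(nnodes T)}) : R := diam (celt K).

Definition meshsize T : R := \big[Num.max/0]_(K in elts T) hE K.

Definition elt_faces T (K : {set 'I_(nnodes T)}) : {set {set 'I_(nnodes T)}} :=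
  [set F : {set 'I_(nnodes T)} | (F \subset K) && (#|F| == d)]%SET.

(* All interior and boundary faces. *)
Definition faces T : {set {set 'I_(nnodes T)}} :=
  [set F : {set 'I_(nnodes T)} | [exists K in elts T, F \in elt_faces K]]%SET.

(* A family of meshes indexed by a set [H] of mesh sizes. *)
Definition shape_regular (H : set R) (T : R -> mesh R d) : Prop :=
  exists2 C : R, 0 < C
    & forall h, H h -> forall K, K \in elts (T h) ->
        hE K <= C * inradius (celt K).

Definition quasi_uniform (H : set R) (T : R -> mesh R d) : Prop :=
  exists2 C : R, 0 < C
    & forall h, H h -> forall K, K \in elts (T h) -> meshsize (T h) <= C * hE K.

Definition outward_normal T (K F : {set 'I_(nnodes T)}) : 'rV[R]_d :=
  get [set n | [/\ enorm n = 1,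
    forall x y, celt F x -> celt F y -> edot n (y - x) = 0
    & forall x y, celt F x -> celt K y -> edot n (y - x) <= 0]].

End Meshes.

Section Spaces.
Context {R : realType} {d : nat}.
Variables (k : nat) (T : mesh R d).

(* L^2 functions on the union of the simplices of [C] which are polynomial on
   each of them. Classes modulo null sets are represented by the function
   vanishing off the (pairwise disjoint) relative interiors of the simplices of
   [C], so that Leibniz equality is equality in L^2. Square integrability is
   automatic. *)
Definition piecewise_poly (C : {set {set 'I_(nnodes T)}})
    : set ('rV[R]_d -> R) :=
  [set v : 'rV[R]_d -> R | (forall F, F \in C ->
              exists2 p, polyfun k p & forall x, oelt F x -> v x = p x) /\
           (forall x, (forall F, F \in C -> ~ oelt F x) -> v x = 0)].

Definition Sh := piecewise_poly (elts T).
Definition hatSh := piecewise_poly (faces T).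

(* Elements (v, hat v) of the product space. *)
Definition bSh : set (('rV[R]_d -> R) * ('rV[R]_d -> R)) :=
  [set v | Sh v.1 /\ hatSh v.2].

End Spaces.

Section Forms.
Context {R : realType} {d : nat}.
Implicit Type T : mesh R d.
Implicit Types u v : ('rV[R]_d -> R) * ('rV[R]_d -> R).

Definition L2dot (Omega : set 'rV[R]_d) (f g : 'rV[R]_d -> R) : R :=
  lebint Omega (fun x => f x * g x).

(* Integral over the boundary of [K] of an integrand depending on the face
   (through the normal) and on the point. *)
Definition bdint T (K : {set 'I_(nnodes T)})
    (g : {set 'I_(nnodes T)} -> 'rV[R]_d -> R) : R :=
  \sum_(F in elt_faces K) surfint (@node R d T) F (g F).

Definition graddot (v w : 'rV[R]_d -> R) x : R :=
  \sum_i partial i v x * partial i w x.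

(* Traces on the boundary of [K], from inside [K], of the normal derivative
   of [v.1] and of the jump [v.1 - v.2]. *)
Definition dnormal T (K F : {set 'I_(nnodes T)}) v x : R :=
  \sum_i trace_from (oelt K) (partial i v.1) x * outward_normal K F 0 i.

Definition jump T (K : {set 'I_(nnodes T)}) v x : R :=
  trace_from (oelt K) v.1 x - v.2 x.

Definition aD T (sigma : R) u v : R :=
  \sum_(K in elts T) lebint (oelt K) (graddot u.1 v.1)
  - \sum_(K in elts T) bdint K (fun F x =>
      dnormal K F u x * jump K v x + jump K u x * dnormal K F v x)
  + \sum_(K in elts T) sigma / hE K * bdint K (fun F x => jump K u x * jump K v x).

(* Square of the norm ||.||_{1,h}. *)
Definition norm1h_sq T v : R :=
  \sum_(K in elts T) lebint (oelt K) (graddot v.1 v.1)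
  + \sum_(K in elts T) (hE K)^-1 * bdint K (fun F x => jump K v x ^+ 2).

End Forms.

Section Potential.
Context {R : realType}.
Implicit Type f : R -> R.

Definition C2 f : Prop :=
  [/\ forall x, derivable f x 1, forall x, derivable (derive1 f) x 1
    & continuous (derive1 (derive1 f))].

Definition convex_fun f : Prop := convex_function [set: R^o] f.
Definition concave_fun f : Prop := convex_fun (\- f).

End Potential.

(* Main.v *)
(* Uniqueness: subtracting two solutions and testing with (dmu, dc) gives
   (Phi_+'(c) - Phi_+'(c'), dc) + kappa a(dc, dc) + tau a(dmu, dmu) = 0, where
   all three terms are nonnegative.  Hence dc and dmu lie in the kernel of the
   positive semidefinite form a, so (dc, chi) = - tau a(dmu, chi) = 0 for all
   chi, and then (dmu, phi) = 0 for all phi; a kernel element whose volume part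
   vanishes has a vanishing face part, by coercivity.

   Existence: in coordinates the scheme reads (c - c0) M + tau mu A = 0 and
   grad G(c) + kappa c A = mu M, with A and M positive semidefinite and G
   convex.  The first equation is solvable in mu iff c - c0 is M-orthogonal to
   ker A.  On this affine space the functional
   G(c) + (kappa / 2) a(c, c) + (1 / (2 tau)) |c - c0|_{-1}^2
   has a minimizer, since a is definite there and G is bounded below by an
   affine function.  Its Lagrange multiplier lies in ker A and can be added to
   mu without changing the first equation. *)

Require Import Defs.
From mathcomp Require Import all_boot all_order all_algebra.
From mathcomp Require Import all_classical all_reals all_analysis.
From mathcomp Require Import measurable_realfun ring lra.
From mathcomp.multinomials Require mpoly.
Import (canonicals, coercions) mpoly.

Set Implicit Arguments.
Unset Strict Implicit.
Unset Printing Implicit Defensive.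

Import Order.TTheory GRing.Theory Num.Theory.
Import numFieldNormedType.Exports.

Local Open Scope classical_set_scope.
Local Open Scope ring_scope.

(* At a dimension [n.+1], [lebint] would otherwise simplify to a bare match. *)
#[local] Arguments lebint : simpl never.

(** * Quadratic forms *)

(** The discrete spaces are spanned by monomials cut off to open simplices. This family is not shown
    to be independent, so the Gram matrices [A] and [M] may share a kernel, which is split off
    before minimizing. Uniqueness is argued on functions, where zero norm means literally zero
    because representatives vanish off the open simplices.

    The potential enters the minimization only through the supporting inequality
    [G y + edot (x - y) (g y) <= G x] and the continuity of [g]: the first is the tangent inequality
    of the convex part, integrated over the elements, the second a local Lipschitz bound. The energy
    is thus never differentiated under the integral. The concave part, taken at the old state, adds
    a fixed linear term, which is why no bound on [tau] appears.

    Integrals are defined for arbitrary functions, so each use of linearity must supply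
    integrability. All integrands agree on the relevant open simplex with a function continuous on
    the whole space ([cext]); this gives measurability and boundedness, and a nonnegative integrand
    of zero integral vanishes pointwise. *)

Section Euclidean_dot.
Context {R : realType} {n : nat}.
Implicit Types x y z : 'rV[R]_n.

Lemma edotE x y : edot x y = (x *m y^T) 0 0.
Proof. by rewrite mxE; apply: eq_bigr => i _; rewrite mxE. Qed.

Lemma edotC x y : edot x y = edot y x.
Proof. by apply: eq_bigr => i _; rewrite mulrC. Qed.

Lemma edotDl x y z : edot (x + y) z = edot x z + edot y z.
Proof. by rewrite !edotE mulmxDl mxE. Qed.

Lemma edotZl a x z : edot (a *: x) z = a * edot x z.
Proof. by rewrite !edotE -scalemxAl mxE. Qed.

Lemma edotDr x y z : edot z (x + y) = edot z x + edot z y.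
Proof. by rewrite ![edot z _]edotC edotDl. Qed.

Lemma edotZr a x z : edot z (a *: x) = a * edot z x.
Proof. by rewrite ![edot z _]edotC edotZl. Qed.

Lemma edotNl x z : edot (- x) z = - edot x z.
Proof. by rewrite -scaleN1r edotZl mulN1r. Qed.

Lemma edotNr x z : edot z (- x) = - edot z x.
Proof. by rewrite ![edot z _]edotC edotNl. Qed.

Lemma edot0l z : edot 0 z = 0.
Proof. by rewrite -(scale0r 0) edotZl mul0r. Qed.

Lemma edot_ge0 x : 0 <= edot x x.
Proof. by apply: sumr_ge0 => i _; rewrite -expr2 sqr_ge0. Qed.

Lemma edot_eq0 x : edot x x = 0 -> x = 0.
Proof.
move=> /eqP; rewrite psumr_eq0; last by move=> i _; rewrite -expr2 sqr_ge0.
move=> /allP x0; apply/rowP => i; rewrite mxE.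
by have := x0 i (mem_index_enum _); rewrite mulf_eq0 orbb => /eqP.
Qed.

Lemma edot_orth x : (forall y, edot x y = 0) -> x = 0.
Proof. by move=> x0; apply: edot_eq0. Qed.

Lemma norm_coord_le x i : `|x 0 i| <= `|x|.
Proof.
rewrite [leRHS]/Num.norm /= mx_normrE.
by apply/bigmax_geP; right => /=; exists (0, i).
Qed.

Lemma norm_edot_le x y : `|edot x y| <= `|x| * \sum_i `|y 0 i|.
Proof.
rewrite mulr_sumr (le_trans (ler_norm_sum _ _ _))// ler_sum// => i _.
by rewrite normrM ler_wpM2r// norm_coord_le.
Qed.

End Euclidean_dot.

Lemma edot_mulmx {R : realType} m n (A : 'M[R]_(m, n)) (x : 'rV_m) (y : 'rV_n) :
  edot (x *m A) y = edot x (y *m A^T).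
Proof. by rewrite !edotE trmx_mul trmxK mulmxA. Qed.

Lemma edot_mulmx_sym {R : realType} n (A : 'M[R]_n) (x y : 'rV_n) : A^T = A ->
  edot (x *m A) y = edot (y *m A) x.
Proof. by move=> sA; rewrite edot_mulmx sA edotC. Qed.

Section Continuity_rV.
Context {R : realType}.

Lemma continuous_compose {T U V : topologicalType} (f : T -> U) (g : U -> V) :
  continuous f -> continuous g -> continuous (fun x => g (f x)).
Proof. by move=> cf cg x; apply: continuous_comp; [exact: cf|exact: cg]. Qed.

Lemma continuous_addr {T : topologicalType} (f g : T -> R) :
  continuous f -> continuous g -> continuous (fun x => f x + g x).
Proof. by move=> cf cg x; apply: cvgD; [exact: cf|exact: cg]. Qed.

Lemma continuous_mulr {T : topologicalType} (f g : T -> R) :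
  continuous f -> continuous g -> continuous (fun x => f x * g x).
Proof. by move=> cf cg x; apply: cvgM; [exact: cf|exact: cg]. Qed.

Lemma continuous_sum {T : topologicalType} (I : Type) (r : seq I) (P : pred I)
    (f : I -> T -> R) :
  (forall i, P i -> continuous (f i)) ->
  continuous (fun x => \sum_(i <- r | P i) f i x).
Proof.
move=> cf; elim: r => [|i r IH] x.
  by under eq_fun do rewrite big_nil; exact: cvg_cst.
under eq_fun do rewrite big_cons.
case Pi: (P i); last exact: IH.
by apply: continuous_addr => //; exact: cf.
Qed.

Lemma continuous_edot {T : topologicalType} n (f g : T -> 'rV[R]_n) :
  continuous f -> continuous g -> continuous (fun x => edot (f x) (g x)).
Proof.
move=> cf cg; apply: continuous_sum => i _; apply: continuous_mulr => x.
  exact: (@continuous_comp _ _ _ f (fun M : 'rV_n => M 0 i) x (cf x)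
    (@coord_continuous _ _ _ 0 i _)).
exact: (@continuous_comp _ _ _ g (fun M : 'rV_n => M 0 i) x (cg x)
  (@coord_continuous _ _ _ 0 i _)).
Qed.

Lemma rV_continuous {T : topologicalType} n (f : T -> 'rV[R]_n) :
  (forall i, continuous (fun x => f x 0 i)) -> continuous f.
Proof.
move=> cf x; apply/cvg_ballP => e e0.
have : \forall y \near x, forall i : 'I_n, ball (f x 0 i) e (f y 0 i).
  by apply: filter_forall => i; exact: (cvg_ball (cf i x)).
apply: filterS => y H; split => // i j; rewrite ord1; exact: H.
Qed.

Lemma mulmx_continuous m n (A : 'M[R]_(m, n)) :
  continuous (fun x : 'rV[R]_m => x *m A).
Proof.
apply: rV_continuous => i.
have -> : (fun x : 'rV_m => (x *m A) 0 i) = (fun x => \sum_j x 0 j * A j i).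
  by apply/funext => x; rewrite mxE.
apply: continuous_sum => j _; apply: continuous_mulr; last exact: cst_continuous.
exact: coord_continuous.
Qed.

Lemma addmx_continuous n (c : 'rV[R]_n) : continuous (fun w => c + w).
Proof. by move=> x; apply: continuousD; [exact: cst_continuous|exact: cvg_id]. Qed.

End Continuity_rV.

Section Quadratic_forms.
Context {R : realType}.

(** A parabola through the origin with nonzero slope is negative on one side. The test point is
    [- b / (c + 1)], where the added 1 keeps the denominator nonzero when [c = 0]. *)
Lemma lin_quad_ge0 (b c : R) : (forall t, 0 <= 2 * t * b + t ^+ 2 * c) -> b = 0.
Proof.
move=> H; have c0 : 0 <= c by have := H 1; have := H (-1); nra.
have := H (- b / (c + 1)); have c1 : c + 1 != 0 by lra.
have -> : 2 * (- b / (c + 1)) * b + (- b / (c + 1)) ^+ 2 * c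
        = - ((b / (c + 1)) ^+ 2 * (c + 2)) by field.
move=> H1; have : (b / (c + 1)) ^+ 2 = 0 by nra.
move/eqP; rewrite expf_eq0 /= mulf_eq0 invr_eq0 (negPf c1) orbF.
by move/eqP.
Qed.

(** The nonnegative form at [x + t *: y] has no constant term in [t], so its linear coefficient, the
    pairing of [x *m A] with [y], vanishes for every [y]. *)
Lemma psd_ker n (A : 'M[R]_n) (x : 'rV_n) : A^T = A ->
  (forall y, 0 <= edot (y *m A) y) -> edot (x *m A) x = 0 -> x *m A = 0.
Proof.
move=> sA pA x0; apply: edot_orth => y.
apply: (@lin_quad_ge0 _ (edot (y *m A) y)) => t.
have := pA (x + t *: y).
rewrite mulmxDl -scalemxAl !edotDl !edotDr !edotZl !edotZr x0.
by rewrite (edot_mulmx_sym y x)//; congr (_ <= _); ring.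
Qed.

(** Fredholm alternative for the column space of [A]. It is transposed because [submxE] describes
    row spaces: the transposed cokernel of [A^T] lies in [kermx A]. *)
Lemma kermx_orth n p (A : 'M[R]_n) (B : 'M[R]_(n, p)) :
  kermx A *m B = 0 -> exists C, B = A *m C.
Proof.
move=> kB; have : (B^T <= A^T)%MS.
  rewrite submxE; apply/eqP/trmx_inj; rewrite trmx0 trmx_mul trmxK.
  have : ((cokermx A^T)^T <= kermx A)%MS.
    by apply/sub_kermxP; apply: trmx_inj; rewrite trmx_mul trmxK mulmx_coker trmx0.
  by move=> /submxP[D ->]; rewrite -mulmxA kB mulmx0.
move=> /submxP[D /(congr1 trmx)]; rewrite trmx_mul !trmxK => ->.
by exists D^T.
Qed.

(* The unit sphere of the subspace is compact. *)
Lemma coercive_subspace n p (A : 'M[R]_n) (N : 'M[R]_(n, p)) :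
  (forall x, x *m N = 0 -> x != 0 -> 0 < edot (x *m A) x) ->
  exists2 a, 0 < a & forall x, x *m N = 0 -> a * `|x| ^+ 2 <= edot (x *m A) x.
Proof.
move=> pA.
pose S := [set x : 'rV[R]_n | x *m N = 0 /\ `|x| = 1].
have cq : continuous (fun x : 'rV[R]_n => edot (x *m A) x).
  by apply: continuous_edot; [exact: mulmx_continuous|move=> x; exact: cvg_id].
have cS : compact S.
  apply: bounded_closed_compact.
    exists 1; split; first exact: num_real.
    by move=> M M1 x [_ x1] /=; rewrite x1 ltW.
  have -> : S = ((fun x : 'rV_n => x *m N) @^-1` [set 0]) `&`
                ((fun x : 'rV_n => `|x|) @^-1` [set 1]) by [].
  have closed1 (V : normedModType R) (a : V) : closed [set a].
    by apply: accessible_closed_set1; apply: hausdorff_accessible; exact: norm_hausdorff.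
  apply: closedI; apply: closed_comp => //; try exact: closed1.
  - by move=> x _; exact: mulmx_continuous.
  - by move=> x _; exact: norm_continuous.
have scal (x : 'rV[R]_n) : x *m N = 0 -> x != 0 -> S (`|x|^-1 *: x).
  move=> xN x0; split; first by rewrite -scalemxAl xN scaler0.
  by rewrite normrZ ger0_norm ?invr_ge0// mulVf// normr_eq0.
have [[y0 Sy0]|S0] := pselect (S !=set0); last first.
  exists 1 => // x xN; suff -> : x = 0 by rewrite normr0 mul0mx edot0l; lra.
  apply/eqP; apply: contrapT => /negP x0; apply: S0.
  by exists (`|x|^-1 *: x); exact: scal.
have [|z] := @EVT_min_rV R n _ S _ cS (continuous_subspaceT cq); first by exists y0.
rewrite inE => -[zN z1] zmin; exists (edot (z *m A) z).
  by apply: pA => //; rewrite -normr_eq0 z1 oner_eq0.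
move=> x xN; have [->|x0] := eqVneq x 0.
  by rewrite normr0 mul0mx edot0l expr0n /= mulr0.
have := zmin (`|x|^-1 *: x) (mem_set (scal x xN x0)).
rewrite -scalemxAl edotZl edotZr mulrA -expr2 exprVn mulrC.
by rewrite ler_pdivlMr// exprn_gt0// normr_gt0.
Qed.

End Quadratic_forms.

(** * Solving the convex system by constrained minimization *)

Section Convex_system.
Context {R : realType} {n : nat}.
Variables (A M : 'M[R]_n) (tau kappa : R) (c0 : 'rV[R]_n).
Variables (G : 'rV[R]_n -> R) (g : 'rV[R]_n -> 'rV[R]_n).
Hypotheses (tau0 : 0 < tau) (kappa0 : 0 < kappa).
Hypotheses (sA : A^T = A) (sM : M^T = M).
Hypothesis pA : forall x, 0 <= edot (x *m A) x.
Hypothesis AM0 : forall x, x *m A = 0 -> edot (x *m M) x = 0 -> x = 0.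
Hypothesis Gg : forall x y : 'rV[R]_n, G y + edot (x - y) (g y) <= G x.
Hypothesis cg : continuous g.

(** [w *m N = 0] says that [w *m M] is orthogonal to the kernel of [A], the solvability condition of
    the first equation. For such [w], [w *m P] is a preimage of [w *m M] under [A], and [B]
    evaluates the form [A] at it: this is the square of the negative norm. *)
Let N := M *m (kermx A)^T.
Let P := M *m pinvmx A.
Let B := P *m A *m P^T.

(** For symmetric [A] the orthogonal complement of the kernel is the row space, on which
    multiplication by [pinvmx A] and then by [A] is the identity. *)
Let N_range (w : 'rV_n) : w *m N = 0 -> w *m P *m A = w *m M.
Proof.
move=> wN; rewrite /P mulmxA mulmxKpV//.
have /kermx_orth[C wC] : kermx A *m (w *m M)^T = 0.
  by apply: trmx_inj; rewrite trmx_mul trmxK -mulmxA trmx0.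
by rewrite -[w *m M]trmxK wC trmx_mul sA submxMl.
Qed.

(** [Gg] bounds [G x] from below by [l x] and, with the two points exchanged, from above by [u x];
    both tend to [G y] because [g] is continuous. *)
Lemma gradient_continuous : continuous G.
Proof.
move=> y; pose l (x : 'rV[R]_n) := G y + edot (x - y) (g y).
pose u (x : 'rV[R]_n) := G y + edot (x - y) (g x).
have cB : continuous (fun x : 'rV[R]_n => x - y).
  by move=> x; apply: continuousB; [exact: cvg_id|exact: cst_continuous].
have cl : l x @[x --> y] --> G y.
  have : continuous l.
    apply: continuous_addr; first exact: cst_continuous.
    by apply: continuous_edot => //; exact: cst_continuous.
  by move=> /(_ y); rewrite /continuous_at {2}/l subrr edot0l addr0.
have cu : u x @[x --> y] --> G y.
  have : continuous u.
    apply: continuous_addr; first exact: cst_continuous.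
    exact: continuous_edot.
  by move=> /(_ y); rewrite /continuous_at {2}/u subrr edot0l addr0.
apply: (squeeze_cvgr _ cl cu); near=> x; rewrite Gg /= /u.
by have := Gg y x; rewrite -opprB edotNl; lra.
Unshelve. all: by end_near. Qed.

Let J (w : 'rV[R]_n) := G (c0 + w) + kappa / 2 * edot ((c0 + w) *m A) (c0 + w)
           + tau^-1 / 2 * edot (w *m B) w.

Let sB : B^T = B.
Proof. by rewrite /B (trmx_mul (P *m A)) (trmx_mul P) trmxK sA mulmxA. Qed.

Let pB w : 0 <= edot (w *m B) w.
Proof. by rewrite /B mulmxA edot_mulmx trmxK mulmxA pA. Qed.

Let J_continuous : continuous J.
Proof.
apply: continuous_addr; first apply: continuous_addr.
- exact: continuous_compose (@addmx_continuous _ _ c0) gradient_continuous.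
- apply: continuous_mulr; first exact: cst_continuous.
  apply: continuous_edot (@addmx_continuous _ _ c0).
  exact: continuous_compose (@addmx_continuous _ _ c0) (@mulmx_continuous _ _ _ A).
- apply: continuous_mulr; first exact: cst_continuous.
  by apply: continuous_edot; [exact: mulmx_continuous|move=> x; exact: cvg_id].
Qed.

(* On [ker N] the quadratic form of [A] is definite, and the convex [G] is
   bounded below by an affine function. *)
Let minimizer : exists2 w, w *m N = 0 & forall z, z *m N = 0 -> J w <= J z.
Proof.
have [a a0 Ha] : exists2 a, 0 < a &
    forall x, x *m N = 0 -> a * `|x| ^+ 2 <= edot (x *m A) x.
  (* If the form vanishes at [x], then [x *m A = 0]; on the constraint space [x *m M] is
     [x *m P *m A], so its pairing with [x] is zero as well and [AM0] applies. *)
  apply: coercive_subspace => x xN x0; rewrite lt_neqAle pA andbT eq_sym.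
  apply/eqP => xA0; have xA := psd_ker sA pA xA0.
  move/eqP: x0; apply; apply: AM0 => //; rewrite -N_range//.
  by rewrite edot_mulmx sA xA edotC edot0l.
(* [l] is the gradient of the first two terms of [J] at [w = 0], and [L] its sum norm, dual to the
   sup norm. Beyond the radius [r] the growth [kappa / 2 * (a * |z|^2)] outweighs the loss
   [|z| * L], hence [J z >= J 0] there. *)
pose l := g c0 + kappa *: (c0 *m A).
pose L := \sum_i `|l 0 i|.
have L0 : 0 <= L by apply: sumr_ge0.
pose r := 2 * L / (kappa * a).
have r0 : 0 <= r by rewrite divr_ge0 ?mulr_ge0 // ltW.
pose S := [set w : 'rV[R]_n | w *m N = 0 /\ `|w| <= r].
have cS : compact S.
  apply: bounded_closed_compact.
    exists r; split; first exact: num_real.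
    by move=> m rm x [_ xr] /=; rewrite (le_trans xr)// ltW.
  have -> : S = ((fun x : 'rV_n => x *m N) @^-1` [set 0]) `&`
                ((fun x : 'rV_n => `|x|) @^-1` [set x | x <= r]) by [].
  apply: closedI; apply: closed_comp.
  - by move=> x _; exact: mulmx_continuous.
  - by apply: accessible_closed_set1; apply: hausdorff_accessible; exact: norm_hausdorff.
  - by move=> x _; exact: norm_continuous.
  - exact: closed_le.
have S0 : S 0 by split; [rewrite mul0mx|rewrite normr0].
have [|w] := @EVT_min_rV R n J S _ cS (continuous_subspaceT J_continuous).
  by exists 0.
rewrite inE => -[wN wr] wmin; exists w => // z zN.
have [zr|rz] := leP `|z| r; first by apply: wmin; rewrite inE.
apply: (le_trans (wmin 0 (mem_set S0))).
rewrite /J addr0 mul0mx edot0l mulr0 addr0.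
have Hz := Gg (c0 + z) c0; rewrite addrAC subrr add0r in Hz.
have e1 : edot ((c0 + z) *m A) (c0 + z) =
    edot (c0 *m A) c0 + 2 * edot z (c0 *m A) + edot (z *m A) z.
  rewrite mulmxDl !edotDl !edotDr (edot_mulmx_sym z c0)//.
  by rewrite (edotC (c0 *m A) z); ring.
have e2 : edot z l = edot z (g c0) + kappa * edot z (c0 *m A).
  by rewrite edotDr edotZr.
have h3 : - (`|z| * L) <= edot z l.
  by have := norm_edot_le z l; rewrite ler_norml => /andP[].
have h4 : `|z| * L <= kappa / 2 * (a * `|z| ^+ 2).
  have : r * `|z| <= `|z| * `|z| by rewrite ler_wpM2r// ltW.
  have -> : L = r * (kappa * a) / 2 by rewrite /r; field; rewrite !gt_eqF.
  have : 0 < kappa * a by rewrite mulr_gt0.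
  by nra.
have h5 : 0 <= tau^-1 / 2 * edot (z *m B) z.
  by rewrite mulr_ge0// divr_ge0// invr_ge0 ltW.
have h6 : kappa / 2 * (a * `|z| ^+ 2) <= kappa / 2 * edot (z *m A) z.
  by rewrite ler_wpM2l ?Ha// divr_ge0// ltW.
by rewrite e1; nra.
Qed.

(** By [Gg], the increment of [G] from [c] to [c + t *: z] is at most [t] times the pairing of [z]
    with [g] at the far end. Dividing the minimality inequality by [t > 0] gives [0 <= f t], and [t]
    tends to zero by continuity of [g]. Equality comes later from [z] and [- z]. *)
Let stationary w : w *m N = 0 -> (forall z, z *m N = 0 -> J w <= J z) ->
  forall z, z *m N = 0 ->
  0 <= edot z (g (c0 + w)) + kappa * edot ((c0 + w) *m A) z
       + tau^-1 * edot (w *m B) z.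
Proof.
move=> wN wmin z zN; have [c cE] : exists c, c = c0 + w by exists (c0 + w).
rewrite -cE.
pose q := kappa / 2 * edot (z *m A) z + tau^-1 / 2 * edot (z *m B) z.
pose k := kappa * edot (c *m A) z + tau^-1 * edot (w *m B) z.
pose f t := edot z (g (c + t *: z)) + (k + t * q).
have cline : continuous (fun t : R => c + t *: z).
  move=> t; apply: cvgD; first exact: cvg_cst.
  by apply: cvgZr_tmp => //; exact: cvg_id.
have cf : continuous f.
  apply: continuous_addr.
    apply: continuous_edot; first exact: cst_continuous.
    exact: continuous_compose cline cg.
  apply: continuous_addr; first exact: cst_continuous.
  by apply: continuous_mulr; [move=> t; exact: cvg_id|exact: cst_continuous].
have f0 t : 0 < t -> 0 <= f t.
  move=> t0; have := wmin (w + t *: z); rewrite mulmxDl -scalemxAl wN zN.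
  rewrite scaler0 addr0 => /(_ erefl).
  have := Gg c (c + t *: z).
  rewrite /J addrA -cE opprD addNKr -scaleNr edotZl mulNr.
  rewrite !mulmxDl -!scalemxAl !edotDl !edotDr !edotZl !edotZr.
  rewrite (edot_mulmx_sym z c sA) (edot_mulmx_sym z w sB).
  move=> h1 h2; rewrite /f /k /q.
  rewrite -(pmulr_rge0 _ t0).
  move: h1 h2; set G1 := G c; set G2 := G _; set e1 := edot z _.
  set e2 := edot _ z; set e3 := edot (w *m B) z; set e4 := edot _ c.
  set e5 := edot (w *m B) w; set e6 := edot (z *m A) z; set e7 := edot (z *m B) z.
  move=> h1 h2.
  have -> : t * (e1 + (kappa * e2 + tau^-1 * e3 + t * (kappa / 2 * e6 + tau^-1 / 2 * e7)))
    = t * e1 + (kappa / 2 * (e4 + t * e2 + (t * e2 + t * (t * e6)))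
       + tau^-1 / 2 * (e5 + t * e3 + (t * e3 + t * (t * e7)))
       - kappa / 2 * e4 - tau^-1 / 2 * e5) by field; rewrite gt_eqF.
  lra.
have -> : edot z (g c) + kappa * edot (c *m A) z + tau^-1 * edot (w *m B) z = f 0.
  by rewrite /f scale0r mul0r !addr0 /k addrA.
have cf0 : f t @[t --> 0^'+] --> f 0 by apply: cvg_at_right_filter; exact: cf.
by apply: (cvgr_to_ge cf0); near=> t; apply: f0.
Unshelve. all: by end_near. Qed.

Lemma convex_system_solvable : exists c mu : 'rV[R]_n,
  (c - c0) *m M + tau *: (mu *m A) = 0 /\ g c + kappa *: (c *m A) = mu *m M.
Proof.
have [w wN wmin] := minimizer.
pose c := c0 + w; pose m := - tau^-1 *: (w *m P).
have mA : tau *: (m *m A) = - (w *m M).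
  by rewrite /m -scalemxAl scalerA N_range// mulrN mulfV ?gt_eqF// scaleN1r.
pose l := g c + kappa *: (c *m A) - m *m M.
have lz z : z *m N = 0 -> edot z l = 0.
  suff ge0 y : y *m N = 0 -> 0 <= edot y l.
    move=> zN; apply/eqP; rewrite eq_le ge0// andbT.
    by rewrite -oppr_ge0 -edotNl ge0// mulNmx zN oppr0.
  move=> yN; have := stationary wN wmin yN; rewrite -/c.
  rewrite /l !edotDr edotZr edotNr (edotC y (c *m A)).
  suff -> : edot y (m *m M) = - (tau^-1 * edot (w *m B) y) by rewrite opprK.
  rewrite edotC (edot_mulmx_sym _ _ sM) -N_range// /m edotZr mulNr.
  rewrite /B 2!(mulmxA w) (edot_mulmx P^T) trmxK.
  by rewrite (edot_mulmx_sym (w *m P)).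
(* The residual [l] of the second equation is orthogonal to the constraint space, so it lies in the
   row space of [N^T = kermx A *m M]: it is [M] applied to a kernel vector of [A], which is the
   correction added to [m]. *)
have /kermx_orth[C lC] : kermx N *m l^T = 0.
  apply/row_matrixP => i; rewrite row_mul row0.
  apply/rowP => j; rewrite ord1 -edotE mxE lz//.
  by apply/sub_kermxP; exact: row_sub.
exists c, (m + C^T *m kermx A); split.
  by rewrite (mulmxDl m) -mulmxA mulmx_ker mulmx0 addr0 mA /c addrAC subrr add0r subrr.
rewrite (mulmxDl m) -mulmxA.
have -> : C^T *m (kermx A *m M) = l.
  by rewrite -[RHS]trmxK lC trmx_mul /N trmx_mul trmxK sM.
by rewrite /l [RHS]addrC subrK.
Qed.

End Convex_system.

(* The kernel [Z] of [A + M] is split off: [R^N] is the direct sum of [Z] and of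
   the row space of [A + M]. *)
Lemma degenerate_convex_system_solvable {R : realType} N (A M : 'M[R]_N)
    (tau kappa : R) (c0 : 'rV[R]_N) (G : 'rV[R]_N -> R)
    (g : 'rV[R]_N -> 'rV[R]_N) :
  0 < tau -> 0 < kappa -> A^T = A -> M^T = M ->
  (forall x, 0 <= edot (x *m A) x) -> (forall x, 0 <= edot (x *m M) x) ->
  (forall k, edot (k *m A) k = 0 -> edot (k *m M) k = 0 ->
     forall x, edot k (g x) = 0) ->
  (forall x y : 'rV[R]_N, G y + edot (x - y) (g y) <= G x) -> continuous g ->
  exists c mu : 'rV[R]_N,
  (c - c0) *m M + tau *: (mu *m A) = 0 /\ g c + kappa *: (c *m A) = mu *m M.
Proof.
move=> tau0 kappa0 sA sM pA pM gZ Gg cg.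
pose Q := A + M.
have sQ : Q^T = Q by rewrite linearD /= sA sM.
have pQ (x : 'rV[R]_N) : 0 <= edot (x *m Q) x by rewrite mulmxDr edotDl addr_ge0.
have Q0 (x : 'rV[R]_N) : x *m Q = 0 -> x *m A = 0 /\ x *m M = 0.
  move=> xQ; have : edot (x *m Q) x = 0 by rewrite xQ edot0l.
  rewrite mulmxDr edotDl => /eqP; rewrite paddr_eq0// => /andP[/eqP xA /eqP xM].
  by split; exact: psd_ker.
have [E [freeE [X EX]]] : exists E : 'M[R]_(\rank Q, N), row_free E /\ exists X, E = X *m Q.
  exists (row_base Q); split; first exact: row_base_free.
  by apply/submxP; rewrite eq_row_base.
(* A vector that lies both in the row space and in the kernel of the symmetric [Q] is orthogonal to
   itself. *)
have EQ0 (z : 'rV_(\rank Q)) : z *m E *m Q = 0 -> z = 0.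
  move=> zQ; have zE0 : z *m E = 0.
    apply: edot_eq0; rewrite {2}EX mulmxA edotC.
    by rewrite (edot_mulmx_sym _ _ sQ) zQ edot0l.
  by apply/eqP; rewrite -(mulmx_free_eq0 z freeE) zE0.
have split (x : 'rV[R]_N) : exists z, exists k, x = z *m E + k /\ k *m Q = 0.
  have freeEQ : row_free (E *m Q) by apply: inj_row_free => v; rewrite mulmxA; exact: EQ0.
  (* [E *m Q] lies in the row space of [Q] and has the same rank, so the two row spaces coincide. *)
  have : (Q <= E *m Q)%MS.
    have /leqifP := mxrank_leqif_sup (submxMl E Q).
    by rewrite (eqP freeEQ) ltnn; case: ifP.
  move=> /(submx_trans (submxMl x Q))/submxP[z xz].
  exists z, (x - z *m E); split; first by rewrite addrC subrK.
  by rewrite mulmxBl xz mulmxA subrr.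
have orth (x : 'rV[R]_N) : (forall z, edot (z *m E) x = 0) ->
    (forall k, k *m Q = 0 -> edot k x = 0) -> x = 0.
  move=> xE xk; apply: edot_eq0; have [z [k [xzk kQ]]] := split x.
  by rewrite {1}xzk edotDl xE xk// addr0.
have [z0 [k0 [c0E k0Q]]] := split c0.
have EE (F : 'M[R]_N) (z y : 'rV_(\rank Q)) :
    edot (z *m (E *m F *m E^T)) y = edot (z *m E *m F) (y *m E).
  by rewrite !mulmxA edot_mulmx trmxK.
have sEE (F : 'M[R]_N) : F^T = F -> (E *m F *m E^T)^T = E *m F *m E^T.
  by move=> sF; rewrite !trmx_mul trmxK sF mulmxA.
have [||||||z [y [eq1 eq2]]] :=
    @convex_system_solvable R _ (E *m A *m E^T) (E *m M *m E^T) tau kappa z0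
      (fun z => G (z *m E)) (fun z => g (z *m E) *m E^T) tau0 kappa0.
- exact: sEE.
- exact: sEE.
- by move=> x; rewrite EE.
- move=> x /(congr1 (fun v => edot v x)); rewrite !EE edot0l => xA xM.
  apply: EQ0; apply: psd_ker => //.
  by rewrite mulmxDr edotDl xA xM addr0.
- by move=> x v; rewrite edotC edot_mulmx trmxK edotC mulmxBl.
- apply: continuous_compose (@mulmx_continuous _ _ _ E^T).
  exact: continuous_compose (@mulmx_continuous _ _ _ E) cg.
have [_ k0M] := Q0 _ k0Q.
have kA0 (k v : 'rV[R]_N) : k *m Q = 0 -> edot k (v *m A) = 0.
  by move=> /Q0[kA _]; rewrite edotC edot_mulmx_sym// kA edot0l.
have kM0 (k v : 'rV[R]_N) : k *m Q = 0 -> edot k (v *m M) = 0.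
  by move=> /Q0[_ kM]; rewrite edotC edot_mulmx_sym// kM edot0l.
(* Both equations are tested on the two summands. On the row space of [E] they are the reduced
   system; on the kernel of [Q] the terms with [A] and [M] vanish, and [gZ] removes the one with
   [g]. *)
exists (z *m E), (y *m E); split.
  apply: orth => [x|k kQ]; last by rewrite edotDr edotZr kA0// kM0// mulr0 addr0.
  rewrite edot_mulmx -(edot0l x) -eq1 edotC; congr (edot _ x).
  rewrite c0E opprD addrA (mulmxDl _ _ M) mulNmx k0M oppr0 addr0 -mulmxBl.
  by rewrite mulmxDl -scalemxAl !mulmxA.
apply/eqP; rewrite -subr_eq0; apply/eqP; apply: orth => [x|k kQ].
  rewrite edot_mulmx -(edot0l x) edotC; congr (edot _ x).
  apply/eqP; rewrite mulmxBl mulmxDl -scalemxAl subr_eq0; apply/eqP.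
  by move: eq2; rewrite !mulmxA.
rewrite !edotDr edotNr edotZr kA0// kM0// mulr0 oppr0 !addr0.
have [kA kM] := Q0 _ kQ.
by apply: gZ; rewrite ?kA ?kM edot0l.
Qed.

(** * Convex functions and C2 functions of one real variable *)

Section Convex_real_functions.
Context {R : realType}.
Implicit Type f : R -> R.

(** Convexity bounds the difference quotient at [x] in the direction [y - x] by [f y - f x] for all
    steps [t] in (0, 1); its limit from the right is the directional derivative. *)
Lemma convex_fun_ge_tangent f x y : convex_fun f -> derivable f x 1 ->
  f x + derive1 f x * (y - x) <= f y.
Proof.
move=> cf df; have diff_f : differentiable f x by exact/derivable1_diffP.
pose v := y - x.
have Dv : 'D_v f x = derive1 f x * v.
  rewrite derive1E !deriveE// mulrC -[X in 'd f x X](mulr1 v).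
  by rewrite -[v * 1]/(v *: (1 : R^o)) linearZ.
have : derivable f x v by exact: diff_derivable.
move=> /cvg_dnbhs_at_right; rewrite -/('D_v f x) Dv => lim_v.
rewrite addrC -lerBrDr; apply: (cvgr_to_le lim_v).
have t1 : \forall t \near (0:R)^'+, t < 1 by exact: nbhs_right_lt.
have t0 : \forall t \near (0:R)^'+, 0 < t by exact: nbhs_right_gt.
apply: filterS2 t0 t1 => t t0 t1 /=.
have := cf (Itv01 (ltW t0) (ltW t1)) y x; rewrite !inE => /(_ I I).
rewrite [X in f X <= _]convRE convRE /= /unstable.onem /v /shift /= => H.
rewrite /GRing.scale /= ler_pdivrMl// lerBlDr.
have -> : t * (y - x) + x = t * y + (1 - t) * x by ring.
by apply: (le_trans H); lra.
Qed.

Lemma convex_fun_derive1_mono f x y : convex_fun f ->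
  (forall z, derivable f z 1) ->
  0 <= (derive1 f x - derive1 f y) * (x - y).
Proof.
move=> cf df; have := convex_fun_ge_tangent x cf (df y).
by have := convex_fun_ge_tangent y cf (df x); nra.
Qed.

Lemma C2_continuous f : C2 f -> continuous f.
Proof. by move=> [df _ _] x; exact/differentiable_continuous/derivable1_diffP. Qed.

Lemma C2_derive1_continuous f : C2 f -> continuous (derive1 f).
Proof. by move=> [_ df _] x; exact/differentiable_continuous/derivable1_diffP. Qed.

(** The mean value theorem with a bound of the second derivative on [[- B, B]]. This is what makes
    the nonlinear load vector depend continuously on the coefficients. *)
Lemma C2_derive1_lipschitz f B : C2 f -> exists2 L, 0 <= L &
  forall a b, `|a| <= B -> `|b| <= B -> `|derive1 f a - derive1 f b| <= L * `|a - b|.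
Proof.
move=> C2f; have [_ ddf cddf] := C2f; have cdf := C2_derive1_continuous C2f.
have [M' [_ HM']] : bounded_set (derive1 (derive1 f) @` `[- B, B]).
  apply: compact_bounded; apply: continuous_compact; last exact: segment_compact.
  exact: continuous_subspaceT.
(* [bounded_set] provides a bound by every number strictly above [M']; this one is also
   nonnegative. *)
exists (`|M'| + 1) => //.
have HM x : -B <= x <= B -> `|derive1 (derive1 f) x| <= `|M'| + 1.
  move=> xB; apply: HM'; first by rewrite (le_lt_trans (ler_norm _))// ltrDl.
  by exists x => //=; rewrite in_itv.
suff H a b : a <= b -> `|a| <= B -> `|b| <= B ->
    `|derive1 f a - derive1 f b| <= (`|M'| + 1) * `|a - b|.
  move=> a b aB bB; have [ab|/ltW ba] := leP a b; first exact: H.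
  by rewrite distrC (distrC a); exact: H.
move=> ab /ler_normlP[Ba aB] /ler_normlP[Bb bB].
have [||c cab E] := @MVT_segment R (derive1 f) (derive1 (derive1 f)) a b ab.
- by move=> x _; rewrite derive1E; exact: derivableP.
- exact: continuous_subspaceT.
rewrite (distrC (derive1 f a)) E normrM (distrC a b); apply: ler_wpM2r => //.
by apply: HM; move: cab; rewrite in_itv /= => /andP[? ?]; apply/andP; split; lra.
Qed.

End Convex_real_functions.

(** * Integration of functions with a continuous extension *)

(** The extension is continuous on the whole space, not only on [A]: it is then bounded on bounded
    [A], and the property is stable under sums, products and composition with a continuous function,
    including the nonlinearity. *)
Definition cext {R : realType} n (A : set 'rV[R]_n) (f : 'rV[R]_n -> R) : Prop :=
  exists2 g : 'rV[R]_n -> R, continuous g & forall x, A x -> f x = g x.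

Section Cext.
Context {R : realType} {n : nat}.
Implicit Types (A : set 'rV[R]_n) (f g : 'rV[R]_n -> R).

Lemma cext_continuous A f : continuous f -> cext A f.
Proof. by exists f. Qed.

Lemma cext_eq A f g : (forall x, A x -> f x = g x) -> cext A g -> cext A f.
Proof. by move=> fg [h ch gh]; exists h => // x Ax; rewrite fg// gh. Qed.

Lemma cextD A f g : cext A f -> cext A g -> cext A (fun x => f x + g x).
Proof.
move=> [f' cf ff] [g' cg gg]; exists (fun x => f' x + g' x).
  exact: continuous_addr.
by move=> x Ax; rewrite ff// gg.
Qed.

Lemma cextM A f g : cext A f -> cext A g -> cext A (fun x => f x * g x).
Proof.
move=> [f' cf ff] [g' cg gg]; exists (fun x => f' x * g' x).
  exact: continuous_mulr.
by move=> x Ax; rewrite ff// gg.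
Qed.

Lemma cext_cst A a : cext A (fun=> a).
Proof. exact/cext_continuous/cst_continuous. Qed.

Lemma cextB A f g : cext A f -> cext A g -> cext A (fun x => f x - g x).
Proof.
move=> cf cg; apply: cextD => //.
by apply: (@cext_eq _ _ (fun x => -1 * g x)) => [x _|];
  [rewrite mulN1r|apply: cextM => //; exact: cext_cst].
Qed.

Lemma cext_sum A (I : Type) (r : seq I) (P : pred I) (f : I -> 'rV[R]_n -> R) :
  (forall i, cext A (f i)) -> cext A (fun x => \sum_(i <- r | P i) f i x).
Proof.
move=> cf; elim: r => [|i r IH].
  by apply: cext_eq (cext_cst _ 0) => x _; rewrite big_nil.
case Pi: (P i); last by apply: cext_eq IH => x _; rewrite big_cons Pi.
by apply: cext_eq (cextD (cf i) IH) => x _; rewrite big_cons Pi.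
Qed.

Lemma cext_comp A f (h : R -> R) : continuous h -> cext A f ->
  cext A (fun x => h (f x)).
Proof.
move=> ch [f' cf ff]; exists (fun x => h (f' x)).
  exact: continuous_compose cf ch.
by move=> x Ax; rewrite ff.
Qed.

Lemma cext_bounded A f : bounded_set A -> cext A f ->
  exists2 M, 0 <= M & forall x, A x -> `|f x| <= M.
Proof.
move=> [M [_ HM]] [g cg fg].
pose C := [set x : 'rV[R]_n | `|x| <= `|M| + 1].
have AC : A `<=` C by move=> x; apply: HM; rewrite (le_lt_trans (ler_norm _))// ltrDl.
have cC : compact C.
  apply: bounded_closed_compact.
    exists (`|M| + 1); split; first exact: num_real.
    by move=> m mM x /le_trans; apply; exact: ltW.
  have -> : C = (fun x : 'rV[R]_n => `|x|) @^-1` [set x | x <= `|M| + 1] by [].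
  by apply: closed_comp; [move=> x _; exact: norm_continuous|exact: closed_le].
have [M' [_ HM']] : bounded_set (g @` C).
  by apply: compact_bounded; exact: (continuous_compact (continuous_subspaceT cg)).
exists (`|M'| + 1) => // x Ax; rewrite fg//; apply: HM'.
  by rewrite (le_lt_trans (ler_norm _))// ltrDl.
by exists x => //; exact: AC.
Qed.

End Cext.

(** * Integration against a measure known on cubes *)

Section Box_measure.
Context {R : realType} {n : nat} {d : measure_display} {X : measurableType d}.
Variables (mu : {measure set X -> \bar R}) (e : X -> 'rV[R]_n).
Hypothesis mu_ball : forall (x : 'rV[R]_n) r, 0 < r ->
  measurable (e @^-1` ball x r) /\ mu (e @^-1` ball x r) = ((2 * r) ^+ n)%:E.

(** Balls of the sup norm are cubes, and an open set is the union of the countably many cubes with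
    rational centre and radius [1 / (m + 1)] that it contains. *)
Lemma box_open_measurable (U : set 'rV[R]_n) : open U -> measurable (e @^-1` U).
Proof.
move=> oU.
pose B (q : 'rV[rat]_n * nat) : set 'rV[R]_n :=
  ball (map_mx (@ratr R) q.1) q.2.+1%:R^-1.
pose F q := if `[< B q `<=` U >] then e @^-1` B q else set0.
have -> : e @^-1` U = \bigcup_q F q.
  apply/seteqP; split => [z Uz|z [q _]]; last first.
    by rewrite /F; case: asboolP => // BU /BU.
  have /nbhs_ballP[r /= r0 rU] : nbhs (e z) U by exact: open_nbhs_nbhs.
  (* This makes [2 / (m + 1) < r]: a cube of radius [1 / (m + 1)] around a rational point that close
     to [e z] stays in the ball of radius [r]. *)
  pose m := Num.truncn (2 / r); have hm : 2 / r < m.+1%:R by exact: truncnS_gt.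
  have m0 : 0 < m.+1%:R^-1 :> R by rewrite invr_gt0.
  have h2 : m.+1%:R^-1 + m.+1%:R^-1 < r.
    move: hm m0; rewrite ltr_pdivrMr// invr_gt0 => hm k0.
    rewrite -[ltRHS](mulKf (_ : m.+1%:R != 0)) ?gt_eqF// -mulr2n -[_ *+ 2]mulr_natr.
    by rewrite ltr_pM2l// invr_gt0.
  have /fin_all_exists[q qz] : forall i : 'I_n, exists q : rat,
      ball (e z 0 i) m.+1%:R^-1 (ratr q : R).
    move=> i; have [|q] := @rat_in_itvoo R (e z 0 i - m.+1%:R^-1) (e z 0 i + m.+1%:R^-1).
      by rewrite ltrBlDr -addrA ltrDl addr_gt0.
    by move=> hq; exists q; rewrite ball_itv /=.
  pose Q := (\row_i q i, m).
  have eQ : B Q (e z).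
    split => // i j; rewrite ord1 !mxE; exact: ball_sym.
  exists Q => //; rewrite /F asboolT// => y Qy.
  apply: rU; apply: (le_ball (ltW h2)); apply: ball_triangle Qy.
  exact: ball_sym.
apply: countable_bigcupT_measurable; first exact: countableP.
move=> q; rewrite /F; case: ifP => // _.
by have [] := mu_ball (map_mx (@ratr R) q.1) (_ : 0 < q.2.+1%:R^-1).
Qed.

Let mfun (f : 'rV[R]_n -> R) : continuous f -> measurable_fun setT (f \o e).
Proof.
move=> /continuousP cf; apply: (measurability _ (RGenOpens.measurableE R)).
move=> _ [_ [a [b ->] <-]]; rewrite setTI comp_preimage.
exact/box_open_measurable/cf/interval_open.
Qed.

Variable A : set 'rV[R]_n.
Hypotheses (oA : open A) (bA : bounded_set A).

Let mA : measurable (e @^-1` A). Proof. exact: box_open_measurable. Qed.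

Let muA : (mu (e @^-1` A) < +oo)%E.
Proof.
have [r r0 Ar] : exists2 r, 0 < r & A `<=` ball 0 r.
  have [M [_ HM]] := bA; exists (`|M| + 2) => [|x Ax]; first by rewrite ltr_pwDr.
  rewrite mx_norm_ball /ball_ /= sub0r normrN.
  apply: (@le_lt_trans _ _ (`|M| + 1)); last by rewrite ltrD2l ltr1n.
  by apply: HM => //; rewrite (le_lt_trans (ler_norm _))// ltrDl.
have [mB EB] := mu_ball 0 r0.
apply: (@le_lt_trans _ _ (mu (e @^-1` ball 0 r))); last by rewrite EB ltry.
by apply: le_measure; rewrite ?inE// => z /Ar.
Qed.

Lemma box_integrable f : cext A f -> mu.-integrable (e @^-1` A) (EFin \o (f \o e)).
Proof.
move=> [g cg fg].
have : mu.-integrable (e @^-1` A) (EFin \o (g \o e)).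
  apply: measurable_bounded_integrable => //.
    by apply: (measurable_funS measurableT) => //; exact: mfun.
  have [M _ gM] := cext_bounded bA (cext_continuous A cg).
  exists M; split; first exact: num_real.
  by move=> r /ltW Mr z Az; apply: le_trans Mr; exact: gM.
apply: eq_integrable => // z; rewrite inE => Az.
by rewrite /= fg.
Qed.

Lemma box_integral_lin f g a : cext A f -> cext A g ->
  \int[mu]_(z in e @^-1` A) (a * f (e z) + g (e z)) =
  a * \int[mu]_(z in e @^-1` A) f (e z) + \int[mu]_(z in e @^-1` A) g (e z).
Proof.
move=> cf cg; rewrite RintegralD//.
- by rewrite RintegralZl//; exact: (box_integrable cf).
- exact: (box_integrable (cextM (cext_cst _ a) cf)).
- exact: (box_integrable cg).
Qed.

(** If [f x > 0], the continuous extension exceeds [f x / 2] on a cube around [x] inside the open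
    set [A], and the integral is at least [f x / 2] times the positive volume of that cube. *)
Lemma box_integral_eq0 f : cext A f -> (forall x, A x -> 0 <= f x) ->
  \int[mu]_(z in e @^-1` A) f (e z) = 0 -> forall x, A x -> f x = 0.
Proof.
move=> cf f0 If x Ax; apply/eqP; apply/negP => /negP fx.
have fx0 : 0 < f x by rewrite lt_neqAle eq_sym fx f0.
have [g cg fg] := cf.
have : \forall y \near x, A y /\ f x / 2 < g y.
  near=> y; split.
    by near: y; exact: open_nbhs_nbhs.
  near: y; apply: (cvgr_gt (g x) (cg x)).
  by rewrite -fg//; lra.
move=> /nbhs_ballP[r /= r0 rA].
have [mB EB] := mu_ball x r0.
have BA : e @^-1` ball x r `<=` e @^-1` A by move=> z /rA[].
suff : 0 < \int[mu]_(z in e @^-1` A) f (e z) by rewrite If ltxx.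
have iA := box_integrable cf.
have iB : mu.-integrable (e @^-1` ball x r) (EFin \o (f \o e)).
  exact: integrableS iA.
apply: (@lt_le_trans _ _ (\int[mu]_(z in e @^-1` ball x r) (f x / 2))).
  rewrite Rintegral_cst// EB /= mulr_gt0 ?divr_gt0// exprn_gt0//.
  exact: mulr_gt0.
apply: (@le_trans _ _ (\int[mu]_(z in e @^-1` ball x r) f (e z))).
  apply: le_Rintegral => //.
    apply: measurable_bounded_integrable => //; first by rewrite EB ltry.
    by exists `|f x / 2|; split => // M /ltW + z _; rewrite /=.
  by move=> z /rA[Az]; rewrite -(fg (e z))// => /ltW.
rewrite -(setIidr BA) Rintegral_mkcondr.
have iP : mu.-integrable (e @^-1` A) (EFin \o ((f \o e) \_ (e @^-1` ball x r))).
  apply: (@integrableS _ _ _ _ setT) => //.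
  by rewrite -restrict_EFin; exact: (iffLR (integrable_mkcond _ mB) iB).
apply: (le_Rintegral mA iP iA) => z Az.
by rewrite patchE; case: ifP => // _; exact: f0.
Unshelve. all: by end_near. Qed.

End Box_measure.

(** * Integrals over disjoint pieces *)

Section Box_partition.
Context {R : realType} {d : measure_display} {X : measurableType d}.
Variable mu : {measure set X -> \bar R}.

Lemma Rintegral_sum (I : Type) (r : seq I) (P : pred I) (h : I -> X -> R) :
  (forall i, P i -> mu.-integrable setT (EFin \o h i)) ->
  \int[mu]_x (\sum_(i <- r | P i) h i x) = \sum_(i <- r | P i) \int[mu]_x h i x.
Proof.
move=> ih.
have isum (s : seq I) : mu.-integrable setT (EFin \o (fun x => \sum_(i <- s | P i) h i x)).
  have -> : EFin \o (fun x => \sum_(i <- s | P i) h i x) =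
      (fun x => \sum_(i <- s | P i) (h i x)%:E)%E.
    by apply/funext => x /=; rewrite sumEFin.
  exact: integrable_sum.
elim: r => [|i r IH].
  rewrite big_nil; under eq_Rintegral do rewrite big_nil.
  by rewrite Rintegral_cst// mul0r.
rewrite big_cons; case Pi: (P i).
  under eq_Rintegral do rewrite big_cons Pi.
  by rewrite RintegralD// ?IH//; exact: ih.
by under eq_Rintegral do rewrite big_cons Pi.
Qed.

(** The restriction of [f] to [A] is pointwise the sum of its restrictions to the pieces. The part
    of [A] outside the pieces, such as the skeleton of a mesh, is covered by the vanishing of [f]
    there instead of a null set argument. *)
Lemma Rintegral_partition (I : finType) (P : pred I) (B : I -> set X)
    (A : set X) (f : X -> R) :
  (forall i, P i -> measurable (B i)) ->
  (forall i, P i -> mu.-integrable (B i) (EFin \o f)) ->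
  (forall i, P i -> B i `<=` A) ->
  (forall i j x, P i -> P j -> B i x -> B j x -> i = j) ->
  (forall x, A x -> (forall i, P i -> ~ B i x) -> f x = 0) ->
  \int[mu]_(x in A) f x = \sum_(i | P i) \int[mu]_(x in B i) f x.
Proof.
move=> mB iB BA tB f0; rewrite Rintegral_mkcond.
under eq_bigr do rewrite Rintegral_mkcond.
rewrite -Rintegral_sum; last first.
  move=> i Pi; rewrite -restrict_EFin.
  by apply/(integrable_mkcond (EFin \o f) (mB i Pi)); exact: iB.
congr Rintegral; apply/funext => x.
have [[i [Pi Bx]]|nB] := pselect (exists i, P i /\ B i x).
  rewrite (bigD1 i)//= big1 ?addr0.
    by rewrite !patchE !mem_set//; exact: BA Bx.
  move=> j /andP[Pj ji]; rewrite patchE memNset// => Bj.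
  by move/eqP: ji; apply; exact: tB Bj Bx.
rewrite big1; last first.
  by move=> i Pi; rewrite patchE memNset// => Bx; apply: nB; exists i.
rewrite patchE; case: ifP => // /set_mem Ax; apply: f0 => // i Pi Bx.
by apply: nB; exists i.
Qed.

End Box_partition.

(** * Lebesgue integrals in dimensions one, two and three *)

Section Lebint.
Context {R : realType}.
Local Notation leb := (@lebesgue_measure R).

Lemma vec_ball n (s : seq R) (x : 'rV[R]_n) r : 0 < r ->
  ball x r (vec n s) = forall i : 'I_n, ball (x 0 i) r s`_i.
Proof.
move=> r0; apply/propext; split => [[_ H] i|H].
  by have := H 0 i; rewrite mxE.
by split => // i j; rewrite ord1 mxE.
Qed.

Let lebmE (x r : R) : 0 < r ->
  (leb : {measure set (measurableTypeR R) -> \bar R}) (ball x r) = (2 * r)%:E.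
Proof. by move=> r0; rewrite /= lebesgue_measure_ball ?ltW// mulr_natl. Qed.

(** A common interface to the three cases of [lebint]: a measure space with a coordinate map under
    which cubes are measurable with the expected volume. The later facts on [lebint] rest on it
    alone. *)
Lemma lebint_box n : (0 < n < 4)%N ->
  exists (d : measure_display) (X : measurableType d)
    (mu : {measure set X -> \bar R}) (e : X -> 'rV[R]_n),
  (forall (x : 'rV[R]_n) r, 0 < r ->
    measurable (e @^-1` ball x r) /\ mu (e @^-1` ball x r) = ((2 * r) ^+ n)%:E) /\
  (forall A f, lebint A f = \int[mu]_(z in e @^-1` A) f (e z)).
Proof.
case: n => [|[|[|[|//]]]]// _.
- exists _, (measurableTypeR R), leb, (fun x => vec 1 [:: x]); split => // x r r0.
  have -> : (fun x0 => vec 1 [:: x0]) @^-1` ball x r = ball (x 0 0) r.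
    apply/seteqP; split => z /=; rewrite (vec_ball _ _ r0); first by move=> /(_ 0).
    by move=> H i; rewrite ord1.
  by split; [exact: measurable_ball|rewrite lebmE].
- exists _, _, (leb \x leb)%E, (fun z => vec 2 [:: z.1; z.2]); split => // x r r0.
  have -> : (fun z => vec 2 [:: z.1; z.2]) @^-1` ball x r =
      ball (x 0 0) r `*` ball (x 0 1) r.
    apply/seteqP; split => z /=; rewrite (vec_ball _ _ r0).
      by move=> H; split; [exact: (H 0)|exact: (H 1)].
    move=> [H0 H1] [[|[|//]] i]; first by rewrite (_ : Ordinal i = 0)//; apply/val_inj.
    by rewrite (_ : Ordinal i = 1)//; apply/val_inj.
  have mb (y : R) : measurable (ball y r : set (measurableTypeR R)) by exact: measurable_ball.
  split; first by exact: measurableX.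
  apply: (etrans (product_measure1E leb leb (mb _) (mb _))).
  by rewrite !lebmE// -EFinM expr2.
- exists _, _, ((leb \x leb) \x leb)%E, (fun z => vec 3 [:: z.1.1; z.1.2; z.2]).
  split => // x r r0.
  have -> : (fun z => vec 3 [:: z.1.1; z.1.2; z.2]) @^-1` ball x r =
      (ball (x 0 0) r `*` ball (x 0 1) r) `*` ball (x 0 2) r.
    apply/seteqP; split => z /=; rewrite (vec_ball _ _ r0).
      by move=> H; split; [split; [exact: (H 0)|exact: (H 1)]|exact: (H 2)].
    move=> [[H0 H1] H2] [[|[|[|//]]] i].
    + by rewrite (_ : Ordinal i = 0)//; apply/val_inj.
    + by rewrite (_ : Ordinal i = 1)//; apply/val_inj.
    + by rewrite (_ : Ordinal i = 2)//; apply/val_inj.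
  have mb (y : R) : measurable (ball y r : set (measurableTypeR R)) by exact: measurable_ball.
  split; first by apply: measurableX => //; exact: measurableX.
  apply: (etrans (product_measure1E (leb \x leb)%E leb (measurableX (mb _) (mb _)) (mb _))).
  rewrite lebmE//; apply: (etrans (congr1 (fun u => (u * _)%E)
    (product_measure1E leb leb (mb (x 0 0)) (mb (x 0 1))))).
  by rewrite !lebmE// -!EFinM exprSr expr2.
Qed.

Variable n : nat.
Hypothesis n_range : (0 < n < 4)%N.
Implicit Types (A : set 'rV[R]_n) (f g : 'rV[R]_n -> R).

Lemma eq_lebint A f g : (forall x, A x -> f x = g x) -> lebint A f = lebint A g.
Proof.
move=> fg; have [d [X [mu [e [_ E]]]]] := lebint_box n_range.
by rewrite !E; apply: eq_Rintegral => z; rewrite inE => /fg.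
Qed.

Lemma lebint_ge0 A f : (forall x, A x -> 0 <= f x) -> 0 <= lebint A f.
Proof.
move=> f0; have [d [X [mu [e [_ E]]]]] := lebint_box n_range.
by rewrite E; apply: Rintegral_ge0 => z /f0.
Qed.

Lemma lebint_lin A f g a : open A -> bounded_set A -> cext A f -> cext A g ->
  lebint A (fun x => a * f x + g x) = a * lebint A f + lebint A g.
Proof.
move=> oA bA cf cg; have [d [X [mu [e [mue E]]]]] := lebint_box n_range.
by rewrite !E; exact: box_integral_lin.
Qed.

Lemma lebint_eq0 A f : open A -> bounded_set A -> cext A f ->
  (forall x, A x -> 0 <= f x) -> lebint A f = 0 -> forall x, A x -> f x = 0.
Proof.
move=> oA bA cf f0; have [d [X [mu [e [mue E]]]]] := lebint_box n_range.
by rewrite E; exact: box_integral_eq0.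
Qed.

Lemma lebint_partition (I : finType) (P : pred I) (B : I -> set 'rV[R]_n) A f :
  (forall i, P i -> [/\ open (B i), bounded_set (B i), cext (B i) f & B i `<=` A]) ->
  (forall i j x, P i -> P j -> B i x -> B j x -> i = j) ->
  (forall x, A x -> (forall i, P i -> ~ B i x) -> f x = 0) ->
  lebint A f = \sum_(i | P i) lebint (B i) f.
Proof.
move=> HB tB f0; have [d [X [mu [e [mue E]]]]] := lebint_box n_range.
rewrite E; under eq_bigr do rewrite E.
apply: Rintegral_partition.
- by move=> i /HB[oB bB _ _]; exact: (box_open_measurable mue).
- by move=> i /HB[oB bB cB _]; exact: (box_integrable mue oB bB cB).
- by move=> i /HB[_ _ _ BA] z /BA.
- by move=> i j x; exact: tB.
- by move=> x; exact: f0.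
Qed.

End Lebint.

(** * Simplices *)

(** The determinant of [t B B^T + (1 - t) I] is a polynomial in [t] with value 1 at 0. For [t] in
    [0, 1] the matrix is positive definite, so the polynomial has no root there and stays positive
    up to [t = 1]. *)
Lemma gram_det_gt0 {R : realType} m n (B : 'M[R]_(m, n)) :
  row_free B -> 0 < \det (B *m B^T).
Proof.
move=> freeB.
pose Bp := map_mx (@polyC R) B.
pose p : {poly R} := \det ('X *: (Bp *m Bp^T) + (1 - 'X)%:M).
have pE t : p.[t] = \det (t *: (B *m B^T) + (1 - t)%:M).
  have BpE : map_mx (horner_eval t) Bp = B.
    by apply/matrixP => i j; rewrite !mxE /horner_eval hornerC.
  rewrite -[LHS]/(horner_eval t p) /p -det_map_mx map_mxD map_mxZ map_mxM -map_trmx.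
  rewrite BpE map_scalar_mx rmorphB rmorph1 /= /horner_eval !hornerE.
  by [].
have np t : 0 <= t <= 1 -> ~~ root p t.
  move=> /andP[t0 t1]; rewrite rootE pE -/(_ \is a GRing.unit).
  suff : t *: (B *m B^T) + (1 - t)%:M \in unitmx by rewrite unitmxE unitfE.
  rewrite -row_free_unit; apply: inj_row_free => v vG.
  have : t * edot (v *m B) (v *m B) + (1 - t) * edot v v = 0.
    rewrite -(edot0l v) -vG mulmxDr edotDl -scalemxAr edotZl.
    by rewrite mul_mx_scalar edotZl mulmxA (edot_mulmx B^T) trmxK.
  move/eqP; rewrite paddr_eq0 ?mulr_ge0 ?edot_ge0 ?subr_ge0//.
  rewrite !mulf_eq0 subr_eq0 => /andP[/orP[/eqP t00|/eqP/edot_eq0 vB]].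
    by rewrite t00 oner_eq0 /= => /eqP/edot_eq0.
  by move=> _; apply/eqP; rewrite -(mulmx_free_eq0 v freeB) vB.
have p0 : p.[0] = 1 by rewrite pE scale0r add0r subr0 det1.
have p1 : p.[1] = \det (B *m B^T) by rewrite pE scale1r subrr (raddf0 (@scalar_mx R m)) addr0.
rewrite -p1 ltNge; apply/negP => p1le.
have [||t /np/negP nr r] := @poly_ivt R (- p) 0 1 => //.
  by rewrite !hornerN p0 oppr_le0 oppr_ge0 ler01.
by apply: nr; rewrite rootN in r.
Qed.

(** * Barycentric coordinates *)

Section Barycentric.
Context {R : realType} {d : nat} {I : finType}.
Variable p : I -> 'rV[R]_d.
Implicit Types F K : {set I}.

Lemma osimplexS F : osimplex p F `<=` csimplex p F.
Proof. by move=> x [l [l0 l1 ->]]; exists l; split => // i /l0/ltW. Qed.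

Lemma sum_extend (V : nmodType) F K (G : I -> V) : F \subset K ->
  \sum_(i in F) G i = \sum_(i in K) (if i \in F then G i else 0).
Proof.
move=> FK; rewrite -big_mkcondr; apply: eq_bigl => i.
by case iF: (i \in F); rewrite ?andbF// andbT (fintype.subsetP FK).
Qed.

Lemma barycentric_unique K (l m : I -> R) : affinely_independent p K ->
  \sum_(i in K) l i = \sum_(i in K) m i ->
  \sum_(i in K) l i *: p i = \sum_(i in K) m i *: p i ->
  forall i, i \in K -> l i = m i.
Proof.
move=> indep s1 sp i iK; apply/eqP; rewrite -subr_eq0; apply/eqP.
apply: (indep (fun i => l i - m i)) => //.
  by rewrite sumrB s1 subrr.
by under eq_bigr do rewrite scalerBl; rewrite sumrB sp subrr.
Qed.

Lemma affinely_independentS F K : F \subset K ->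
  affinely_independent p K -> affinely_independent p F.
Proof.
move=> FK indep l l0 lp i iF.
have := indep (fun i => if i \in F then l i else 0).
rewrite -sum_extend// => /(_ l0) H; have := H _ i (fintype.subsetP FK i iF).
rewrite iF; apply; apply: etrans lp; rewrite (sum_extend _ FK); apply: eq_bigr => j _.
by case: ifP => // _; rewrite scale0r.
Qed.

(** The coordinates of [x] with respect to [K] are unique: they are positive on [S], and they vanish
    outside [S']. *)
Lemma osimplex_sub K (S S' : {set I}) x : affinely_independent p K ->
  S \subset K -> S' \subset K -> osimplex p S x -> csimplex p S' x -> S \subset S'.
Proof.
move=> indep SK S'K [l [l0 l1 lx]] [m [m0 m1 mx]].
apply/fintype.subsetP => i iS; apply/negPn/negP => iS'.
have := @barycentric_unique K (fun i => if i \in S then l i else 0)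
  (fun i => if i \in S' then m i else 0) indep.
rewrite -!sum_extend// l1 m1 => /(_ erefl) H.
have := H _ i (fintype.subsetP SK i iS); rewrite iS (negPf iS') => {}H.
have := l0 i iS; rewrite H ?ltxx//.
transitivity x; [rewrite lx (sum_extend _ SK)|rewrite mx (sum_extend _ S'K)];
  by apply: eq_bigr => j _; case: ifP; rewrite // scale0r.
Qed.

Lemma csimplex_bounded F : bounded_set (csimplex p F).
Proof.
exists (\sum_(i in F) `|p i|); split; first exact: num_real.
move=> M /ltW sM x [l [l0 l1 ->]] /=; apply: le_trans sM.
apply: le_trans (ler_norm_sum _ _ _) _; apply: ler_sum => i iF.
rewrite normrZ ler_piMl// ger0_norm ?l0// -l1 (bigD1 i)//= lerDl.
by apply: sumr_ge0 => j /andP[jF _]; exact: l0.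
Qed.

Lemma osimplex_bounded F : bounded_set (osimplex p F).
Proof.
have [M [Mr HM]] := csimplex_bounded F.
by exists M; split => // m Mm x /osimplexS; exact: HM.
Qed.

(** Moving from [x] slightly towards the barycentre [b] of [K] makes all coordinates positive. *)
Lemma closure_osimplex F K : F \subset K -> csimplex p F `<=` closure (osimplex p K).
Proof.
move=> FK x [l [l0 l1 lx]] U xU.
have K0 : (0 < #|K|)%N.
  rewrite card_gt0; apply/eqP => K0; move: l1; rewrite big1 => [/esym/eqP|i iF].
    by rewrite oner_eq0.
  by move/fintype.subsetP: FK => /(_ i iF); rewrite K0 inE.
have [m [m0 m1]] : exists m : I -> R, (forall i, 0 < m i) /\ \sum_(i in K) m i = 1.
  exists (fun=> #|K|%:R^-1); split; first by move=> i; rewrite invr_gt0 ltr0n.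
  by rewrite sumr_const -[LHS]mulr_natr mulVf// pnatr_eq0 -lt0n.
pose b := \sum_(i in K) m i *: p i.
pose l' i := if i \in F then l i else 0.
have l'0 i : 0 <= l' i by rewrite /l'; case: ifP => // /l0.
have cb : x + t *: (b - x) @[t --> (0:R)^'+] --> x.
  apply: cvg_at_right_filter.
  have : (x + (t : R) *: (b - x)) @[t --> (0 : R)] --> x + (0 : R) *: (b - x).
    apply: cvgD; first exact: cvg_cst.
    by apply: cvgZr_tmp; exact: cvg_id.
  by rewrite scale0r addr0.
have : \forall t \near (0:R)^'+, U (x + t *: (b - x)) by exact: cb.
have : \forall t \near (0:R)^'+, t < 1 by exact: nbhs_right_lt.
have : \forall t \near (0:R)^'+, 0 < t by exact: nbhs_right_gt.
move=> N1 N2 N3.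
have [t [[t0 t1] Ut]] := filter_ex (filterI (filterI N1 N2) N3).
exists (x + t *: (b - x)); split => //.
exists (fun i => (1 - t) * l' i + t * m i); split.
- move=> i _; apply: ltr_wpDl; first by rewrite mulr_ge0// subr_ge0 ltW.
  exact: mulr_gt0.
- rewrite big_split /= -!mulr_sumr m1 -sum_extend// l1; ring.
- have xE : x = \sum_(i in K) l' i *: p i.
    rewrite lx (sum_extend _ FK); apply: eq_bigr => j _.
    by rewrite /l'; case: ifP; rewrite // scale0r.
  under eq_bigr do rewrite scalerDl -!scalerA.
  rewrite big_split /= -!scaler_sumr -xE -/b scalerBl scalerBr scale1r.
  by rewrite addrA addrAC.
Qed.

(** The rows of [P] are the vertices preceded by a 1, which records the sum of the weights. Affine
    independence and the cardinality make [P] invertible, so [y x] is an affine function of [x]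
    giving its barycentric coordinates, and the simplex is where all of them are positive. [pinvmx]
    serves as inverse since the two dimensions of [P] agree only propositionally. *)
Lemma osimplex_open K : #|K| = d.+1 -> affinely_independent p K ->
  open (osimplex p K).
Proof.
move=> cardK indep.
have [k0 k0K] : exists k0, k0 \in K by apply/card_gt0P; rewrite cardK.
pose P : 'M[R]_(#|K|, 1 + d) := \matrix_j row_mx 1 (p (enum_val j)).
have mulP (v : 'rV_#|K|) :
    v *m P = row_mx (\sum_j v 0 j)%:M (\sum_j v 0 j *: p (enum_val j)).
  rewrite mulmx_sum_row -[LHS]hsubmxK.
  congr row_mx; rewrite linear_sum /=.
    rewrite (raddf_sum (@scalar_mx R 1)); apply: eq_bigr => j _.
    by rewrite linearZ /= rowK row_mxKl -scalemx1.
  by apply: eq_bigr => j _; rewrite linearZ /= rowK row_mxKr.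
pose l (v : 'rV[R]_#|K|) i := v 0 (enum_rank_in k0K i).
have sl (V : lmodType R) v (q : I -> V) :
    \sum_(i in K) l v i *: q i = \sum_j v 0 j *: q (enum_val j).
  by rewrite big_enum_val; apply: eq_bigr => j _; rewrite /l enum_valK_in.
have sl1 v : \sum_(i in K) l v i = \sum_j v 0 j.
  by rewrite big_enum_val; apply: eq_bigr => j _; rewrite /l enum_valK_in.
have freeP : row_free P.
  apply: inj_row_free => v; rewrite mulP -row_mx0 => /eq_row_mx[v1 vp].
  apply/rowP => j; rewrite mxE -(enum_valK_in k0K j) -/(l v _).
  apply: indep; last exact: enum_valP.
    by rewrite sl1; move/matrixP/(_ 0 0): v1; rewrite !mxE.
  by rewrite sl.
have fullP : row_full P by rewrite /row_full (eqP freeP) cardK.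
pose y x : 'rV[R]_#|K| := row_mx 1 x *m pinvmx P.
have -> : osimplex p K = [set x | forall j, 0 < y x 0 j].
  apply/seteqP; split => [x [m [m0 m1 mx]] j|x Hx].
    have -> : y x = \row_j m (enum_val j).
      rewrite /y -[RHS](mulmxKp freeP) mulP; congr (row_mx _ _ *m _).
        rewrite -[1]/(1%:M); congr (_ %:M); rewrite -m1 big_enum_val.
        by apply: eq_bigr => i _; rewrite mxE.
      by rewrite mx big_enum_val; apply: eq_bigr => i _; rewrite mxE.
    by rewrite /= mxE m0// enum_valP.
  have yP : y x *m P = row_mx 1 x by rewrite mulmxKpV// submx_full.
  move: yP; rewrite mulP => /eq_row_mx[y1 yx].
  exists (l (y x)); split.
  - by move=> i iK; exact: Hx.
  - by rewrite sl1; move/matrixP/(_ 0 0): y1; rewrite !mxE.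
  - by rewrite sl.
have cy j : continuous (fun x => y x 0 j).
  have -> : (fun x => y x 0 j) = (fun x => (1 *m usubmx (pinvmx P)) 0 j + (x *m dsubmx (pinvmx P)) 0 j).
    by apply/funext => z; rewrite /y -{1}[pinvmx P]vsubmxK mul_row_col mxE.
  apply: continuous_addr; first exact: cst_continuous.
  exact: continuous_compose (@mulmx_continuous _ _ _ _) (@coord_continuous _ _ _ 0 j).
rewrite openE => x Hx.
suff : \forall z \near x, forall j, 0 < y z 0 j by [].
have yj j : \forall z \near x, 0 < y z 0 j.
  exact: (cvgr_gt (y x 0 j) (cy j x) 0 (Hx j)).
exact: (@filter_forall _ _ (fun j z => 0 < y z 0 j) (nbhs x) (nbhs_filter x) yj).
Qed.

End Barycentric.

(** * Surface integrals through the parametrization of a face *)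

Section Surface_integral.
Context {R : realType}.

Lemma ref_simplex_open n : open (@ref_simplex R n).
Proof.
have cs : continuous (fun t : 'rV[R]_n => \sum_i t 0 i).
  by apply: continuous_sum => i _; exact: coord_continuous.
rewrite openE => t [t0 t1].
have N0 i : \forall s \near t, 0 < (s : 'rV[R]_n) 0 i.
  exact: (cvgr_gt (t 0 i) (@coord_continuous _ _ _ 0 i t) 0 (t0 i)).
have N1 : \forall s \near t, \sum_i (s : 'rV[R]_n) 0 i < 1.
  exact: (cvgr_lt _ (cs t) 1 t1).
have N0' := @filter_forall _ _ (fun i (s : 'rV[R]_n) => 0 < s 0 i) _ (nbhs_filter t) N0.
suff : \forall s \near t, ref_simplex s by [].
by apply: filterS2 N0' N1 => s s0 s1; split.
Qed.

Lemma ref_simplex_bounded n : bounded_set (@ref_simplex R n).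
Proof.
exists 1; split; first exact: num_real.
move=> M /ltW M1 t [t0 t1] /=; apply: le_trans M1.
rewrite [leLHS]/Num.norm /= mx_normrE; apply/bigmax_leP; split => // -[i j] _ /=.
rewrite ord1 ger0_norm; last exact: ltW.
apply: le_trans (ltW t1).
by rewrite (bigD1 j)//= lerDl sumr_ge0// => k _; exact: ltW.
Qed.

Variables (n : nat) (I : finType) (p : I -> 'rV[R]_n.+1) (F : {set I}).
Hypothesis n_range : (0 < n < 4)%N.
Hypothesis cardF : #|F| = n.+1.
Hypothesis indepF : affinely_independent p F.

Let q := nth 0 [seq p i | i <- enum F].
Let B : 'M[R]_(n, n.+1) := \matrix_(j, i) (q j.+1 - q 0%N) 0 i.
Let param (t : 'rV[R]_n) : 'rV[R]_n.+1 := q 0%N + t *m B.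

(** Holds by computation because the ambient dimension is a successor, so that [d.-1] reduces to
    [n]. *)
Let surfintE (f : 'rV[R]_n.+1 -> R) :
  surfint p F f = Num.sqrt (\det (B *m B^T)) * lebint (@ref_simplex R n) (f \o param).
Proof. by []. Qed.

Let sizeF : size (enum F) = n.+1. Proof. by rewrite -cardE. Qed.

Let i0 : I. Proof. by case: (enum F) sizeF => // i. Defined.

Let v := nth i0 (enum F).

Let qE j : (j < n.+1)%N -> q j = p (v j).
Proof. by move=> jn; rewrite /q (nth_map i0)// sizeF. Qed.

Let sum_vertices (V : nmodType) (G : I -> V) :
  \sum_(i in F) G i = G (v 0%N) + \sum_(j < n) G (v j.+1).
Proof.
rewrite -big_enum (big_nth i0) sizeF big_mkord big_ord_recl.
by congr (_ + _).
Qed.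

(** Turns coefficients listed along the enumeration of [F] into a function on [I], the form in which
    simplices and affine independence are stated. *)
Let weights (a : R) (t : 'rV[R]_n) : exists2 l : I -> R,
  l (v 0%N) = a & forall j : 'I_n, l (v j.+1) = t 0 j.
Proof.
pose s j := if j is j'.+1 then (if insub j' is Some o then t 0 o else 0) else a.
have vK j : (j < n.+1)%N -> index (v j) (enum F) = j.
  by move=> jn; rewrite index_uniq ?sizeF ?enum_uniq.
exists (fun i => s (index i (enum F))); first by rewrite vK.
by move=> j; rewrite vK ?ltnS//= valK.
Qed.

Let mulB t : t *m B = \sum_(j < n) t 0 j *: (q j.+1 - q 0%N).
Proof.
rewrite mulmx_sum_row; apply: eq_bigr => j _; congr (_ *: _).
by apply/rowP => i; rewrite !mxE.
Qed.

Let paramE t : param t = (1 - \sum_j t 0 j) *: q 0%N + \sum_(j < n) t 0 j *: q j.+1.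
Proof.
rewrite /param mulB; under eq_bigr do rewrite scalerBr.
by rewrite sumrB -scaler_suml scalerBl scale1r addrA addrAC.
Qed.

Let param_osimplex t : ref_simplex t -> osimplex p F (param t).
Proof.
move=> [t0 t1]; have [l l0 lj] := weights (1 - \sum_j t 0 j) t.
exists l; split.
- move=> i; rewrite -mem_enum => iF; rewrite -(nth_index i0 iF) -/v.
  have : (index i (enum F) < n.+1)%N by rewrite -sizeF index_mem.
  case: (index i (enum F)) => [_|j jn]; first by rewrite l0 subr_gt0.
  by have := lj (Ordinal (jn : (j < n)%N)); rewrite /= => ->.
- by rewrite sum_vertices l0; under [X in _ + X]eq_bigr do rewrite lj; rewrite subrK.
- rewrite sum_vertices l0 paramE; under [X in _ = _ + X]eq_bigr do rewrite lj.
  rewrite qE//; congr (_ + _); apply: eq_bigr => j _.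
  by rewrite qE// ltnS.
Qed.

Let osimplex_param x : osimplex p F x -> exists2 t, ref_simplex t & x = param t.
Proof.
have vF j : (j < n.+1)%N -> v j \in F.
  by move=> jn; rewrite -mem_enum mem_nth// sizeF.
move=> [l [l0 l1 lx]]; move: l1 lx; rewrite !sum_vertices => l1 lx.
have s1 : \sum_(j < n) (\row_(j < n) l (v j.+1)) 0 j = \sum_(j < n) l (v j.+1).
  by apply: eq_bigr => j _; rewrite mxE.
exists (\row_j l (v j.+1)); first split.
- by move=> j; rewrite mxE l0// vF// ltnS.
- by rewrite s1 -l1 ltrDr l0// vF.
- rewrite paramE s1 -l1 addrK qE// lx; congr (_ + _).
  by apply: eq_bigr => j _; rewrite mxE qE// ltnS.
Qed.

(** A linear relation between the edges [q j.+1 - q 0] is an affine relation between the vertices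
    once [q 0] receives minus the sum of the coefficients. *)
Let freeB : row_free B.
Proof.
apply: inj_row_free => t; rewrite mulB => tB.
have [l l0 lj] := weights (- \sum_j t 0 j) t.
apply/rowP => j; rewrite -lj mxE; apply: indepF.
- by rewrite sum_vertices l0; under [X in _ + X]eq_bigr do rewrite lj; rewrite addNr.
- rewrite sum_vertices l0; under [X in _ + X]eq_bigr do rewrite lj -qE ?ltnS//.
  rewrite -qE// -[RHS]tB; under [in RHS]eq_bigr do rewrite scalerBr.
  by rewrite sumrB -scaler_suml scaleNr addrC.
- by rewrite -mem_enum mem_nth// sizeF ltnS.
Qed.

Let area_gt0 : 0 < Num.sqrt (\det (B *m B^T)).
Proof. by rewrite sqrtr_gt0 gram_det_gt0. Qed.

Let param_continuous : continuous param.
Proof.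
exact: continuous_compose (@mulmx_continuous _ _ _ B) (@addmx_continuous _ _ _).
Qed.

Let cext_param f : cext (osimplex p F) f -> cext (@ref_simplex R n) (f \o param).
Proof.
move=> [g cg fg]; exists (g \o param); first exact: continuous_compose param_continuous cg.
by move=> t /param_osimplex/fg.
Qed.

Lemma eq_surfint f g : (forall x, osimplex p F x -> f x = g x) ->
  surfint p F f = surfint p F g.
Proof.
move=> fg; rewrite !surfintE; congr (_ * _).
by apply: eq_lebint => // t /param_osimplex/fg.
Qed.

Lemma surfint_ge0 f : (forall x, osimplex p F x -> 0 <= f x) -> 0 <= surfint p F f.
Proof.
move=> f0; rewrite surfintE mulr_ge0 ?sqrtr_ge0//.
by apply: lebint_ge0 => // t /param_osimplex/f0.
Qed.

Lemma surfint_lin f g a : cext (osimplex p F) f -> cext (osimplex p F) g ->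
  surfint p F (fun x => a * f x + g x) = a * surfint p F f + surfint p F g.
Proof.
move=> cf cg; rewrite !surfintE.
rewrite (lebint_lin n_range a (@ref_simplex_open n) (@ref_simplex_bounded n)
  (cext_param cf) (cext_param cg)).
by rewrite mulrDr mulrCA.
Qed.

Lemma surfint_eq0 f : cext (osimplex p F) f ->
  (forall x, osimplex p F x -> 0 <= f x) -> surfint p F f = 0 ->
  forall x, osimplex p F x -> f x = 0.
Proof.
move=> cf f0; rewrite surfintE => /eqP; rewrite mulf_eq0 gt_eqF//= => /eqP I0.
move=> x /osimplex_param[t rt ->].
apply: (lebint_eq0 n_range (@ref_simplex_open n) (@ref_simplex_bounded n)
  (cext_param cf) _ I0 rt).
by move=> s /param_osimplex/f0.
Qed.

End Surface_integral.

(** * Piecewise polynomials *)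

Section C1_functions.
Context {R : realType} {d : nat}.
Implicit Types f g : 'rV[R]_d -> R.

Definition C1 f : Prop := continuous f /\
  forall i, (forall x, derivable f x (delta_mx 0 i)) /\ continuous (partial i f).

Lemma C1_cst a : C1 (fun=> a).
Proof.
split; first exact: cst_continuous.
move=> i; split; first by move=> x; exact: derivable_cst.
have -> : partial i (fun=> a) = (fun=> 0) :> ('rV[R]_d -> R).
  by apply/funext => x; rewrite /partial derive_cst.
exact: cst_continuous.
Qed.

Lemma C1_coord j : C1 (fun x : 'rV[R]_d => x 0 j).
Proof.
split; first exact: coord_continuous.
move=> i; split; first by move=> x; exact/diff_derivable/differentiable_coord.
have -> : partial i (fun x => x 0 j) = (fun=> (delta_mx 0 i : 'rV[R]_d) 0 j).
  apply/funext => x; apply/cvg_lim => //.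
  apply: (cvg_trans _ (@cvg_cst R ((delta_mx 0 i : 'rV[R]_d) 0 j) R (0 : R)^' _)).
  have h0 : \forall h \near (0 : R)^', h != 0 by exact: nbhs_dnbhs_neq.
  apply: near_eq_cvg; apply: filterS h0 => h h0; rewrite /= !mxE.
  by apply: (canRL (mulKf h0)); rewrite -[LHS](addrK (x 0 j)).
exact: cst_continuous.
Qed.

Lemma C1D f g : C1 f -> C1 g -> C1 (fun x => f x + g x).
Proof.
move=> [cf df] [cg dg]; split; first exact: continuous_addr.
move=> i; split; first by move=> x; apply: derivableD; [exact: (df i).1|exact: (dg i).1].
have -> : partial i (fun x => f x + g x) = (fun x => partial i f x + partial i g x).
  by apply/funext => x; rewrite /partial deriveD//; [exact: (df i).1|exact: (dg i).1].
by apply: continuous_addr; [exact: (df i).2|exact: (dg i).2].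
Qed.

Lemma C1M f g : C1 f -> C1 g -> C1 (fun x => f x * g x).
Proof.
move=> [cf df] [cg dg]; split; first exact: continuous_mulr.
move=> i; split; first by move=> x; apply: derivableM; [exact: (df i).1|exact: (dg i).1].
have -> : partial i (fun x => f x * g x) =
    (fun x => f x * partial i g x + g x * partial i f x).
  by apply/funext => x; rewrite /partial deriveM//; [exact: (df i).1|exact: (dg i).1].
by apply: continuous_addr; apply: continuous_mulr => //; [exact: (dg i).2|exact: (df i).2].
Qed.

Lemma C1_sum (I : Type) (r : seq I) (F : I -> 'rV[R]_d -> R) :
  (forall i, C1 (F i)) -> C1 (fun x => \sum_(i <- r) F i x).
Proof.
move=> cF; elim: r => [|i r IH].
  by under eq_fun do rewrite big_nil; exact: C1_cst.
by under eq_fun do rewrite big_cons; exact: C1D.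
Qed.

Lemma C1_prod (I : Type) (r : seq I) (F : I -> 'rV[R]_d -> R) :
  (forall i, C1 (F i)) -> C1 (fun x => \prod_(i <- r) F i x).
Proof.
move=> cF; elim: r => [|i r IH].
  by under eq_fun do rewrite big_nil; exact: C1_cst.
by under eq_fun do rewrite big_cons; exact: C1M.
Qed.

Lemma C1X f m : C1 f -> C1 (fun x => f x ^+ m).
Proof.
move=> cf; elim: m => [|m IH]; first by under eq_fun do rewrite expr0; exact: C1_cst.
by under eq_fun do rewrite exprS; exact: C1M.
Qed.

End C1_functions.

Section Polynomials.
Context {R : realType} {d : nat}.
Implicit Types p q : 'rV[R]_d -> R.

Definition monomial (m : mpoly.multinom d) (x : 'rV[R]_d) : R :=
  \prod_i x 0 i ^+ mpoly.fun_of_multinom m i.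

Lemma monomial_C1 m : C1 (monomial m).
Proof. by apply: C1_prod => i; apply: C1X; exact: C1_coord. Qed.

(** [bmultinom d k.+1] is the finite type of exponents of degree less than [k.+1], so polynomials of
    degree at most [k] get a finite spanning family. *)
Lemma polyfun_span k p : polyfun k p <->
  exists a : mpoly.bmultinom d k.+1 -> R,
    forall x, p x = \sum_(m : mpoly.bmultinom d k.+1) a m * monomial (mpoly.bmnm m) x.
Proof.
split=> [[q sq pq]|[a pa]].
  exists (fun m => mpoly.mcoeff (mpoly.bmnm m) q) => x; rewrite pq {1}(mpoly.mpolywE sq).
  rewrite raddf_sum /=; apply: eq_bigr => m _.
  by rewrite mpoly.mevalZ mpoly.mevalX.
exists (\sum_(m : mpoly.bmultinom d k.+1) a m *: mpoly.mpolyX R (mpoly.bmnm m)); last first.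
  move=> x; rewrite pa raddf_sum /=; apply: eq_bigr => m _.
  by rewrite mpoly.mevalZ mpoly.mevalX.
elim/big_ind: _ => [|u v su sv|m _]; first by rewrite mpoly.msize0.
  by rewrite (leq_trans (mpoly.mmeasureD_le _ _ _))// geq_max su.
rewrite (leq_trans (mpoly.msizeZ_le _ _))// mpoly.msizeX.
exact: mpoly.bmdeg.
Qed.

Lemma polyfun_C1 k p : polyfun k p -> C1 p.
Proof.
move=> /polyfun_span[a pa]; have -> : p = fun x => \sum_(m : mpoly.bmultinom d k.+1) a m * monomial (mpoly.bmnm m) x.
  exact/funext.
by apply: C1_sum => m; apply: C1M; [exact: C1_cst|exact: monomial_C1].
Qed.

Lemma polyfun_lin k a p q : polyfun k p -> polyfun k q ->
  polyfun k (fun x => a * p x + q x).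
Proof.
move=> /polyfun_span[b pb] /polyfun_span[c qc]; apply/polyfun_span.
exists (fun m => a * b m + c m) => x; rewrite pb qc mulr_sumr -big_split /=.
by apply: eq_bigr => m _; rewrite mulrDl mulrA.
Qed.

Lemma polyfun_monomial k (m : mpoly.bmultinom d k.+1) :
  polyfun k (monomial (mpoly.bmnm m)).
Proof.
apply/polyfun_span; exists (fun m' => (m' == m)%:R) => x.
by rewrite (bigD1 m)//= eqxx mul1r big1 ?addr0// => m' /negPf ->; rewrite mul0r.
Qed.

End Polynomials.

Section Piecewise.
Context {R : realType} {d k : nat} {T : mesh R d}.
Variable C : {set {set 'I_(nnodes T)}}.
Hypothesis disjC : forall F G x, F \in C -> G \in C ->
  oelt F x -> oelt G x -> F = G.
Implicit Types v w : 'rV[R]_d -> R.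

Lemma piecewise_poly_lin a v w : piecewise_poly k C v -> piecewise_poly k C w ->
  piecewise_poly k C (fun x => a * v x + w x).
Proof.
move=> [vp v0] [wp w0]; split => [F FC|x xC]; last by rewrite v0// w0// mulr0 addr0.
have [p pp vE] := vp F FC; have [q qq wE] := wp F FC.
exists (fun x => a * p x + q x); first exact: polyfun_lin.
by move=> x Fx; rewrite vE// wE.
Qed.

(** The test [F \in C] allows indexing by all vertex sets, which form a finite type; the sets
    outside [C] contribute zero. *)
Definition local_monomial (F : {set 'I_(nnodes T)}) (m : mpoly.bmultinom d k.+1)
    (x : 'rV[R]_d) : R :=
  if (F \in C) && `[< oelt F x >] then monomial (mpoly.bmnm m) x else 0.

Lemma local_monomial_piecewise F m : piecewise_poly k C (local_monomial F m).
Proof.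
split=> [G GC|x xC]; rewrite /local_monomial; last first.
  by case: ifP => // /andP[FC /asboolP Fx]; case: (xC F FC).
have [FG|FG] := eqVneq F G.
  exists (monomial (mpoly.bmnm m)); first exact: polyfun_monomial.
  by move=> x Gx; rewrite FG GC asboolT.
exists (fun=> 0).
  by apply/polyfun_span; exists (fun=> 0) => x; rewrite big1// => m' _; rewrite mul0r.
move=> x Gx; case: ifP => // /andP[FC /asboolP Fx].
by move/eqP: FG; case; exact: disjC Fx Gx.
Qed.

Lemma piecewise_poly_span v : piecewise_poly k C v ->
  exists a : {set 'I_(nnodes T)} * mpoly.bmultinom d k.+1 -> R,
    forall x, v x = \sum_j a j * local_monomial j.1 j.2 x.
Proof.
move=> [vp v0].
have /fin_all_exists[a va] : forall F : {set 'I_(nnodes T)},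
    exists a : mpoly.bmultinom d k.+1 -> R, F \in C ->
      forall x, oelt F x -> v x = \sum_(m : mpoly.bmultinom d k.+1) a m * monomial (mpoly.bmnm m) x.
  move=> F; have [FC|FC] := boolP (F \in C); last by exists (fun=> 0).
  have [p /polyfun_span[a pa] vE] := vp F FC.
  by exists a => _ x Fx; rewrite vE.
exists (fun j => a j.1 j.2) => x.
rewrite -(pair_bigA _ (fun F m => a F m * local_monomial F m x)) /=.
have [[F [FC Fx]]|nF] := pselect (exists F, F \in C /\ oelt F x).
  rewrite (bigD1 F)//= [X in _ + X]big1 ?addr0.
    rewrite (va F FC x Fx); apply: eq_bigr => m _.
    by rewrite /local_monomial FC asboolT.
  move=> G GF; apply: big1 => m _; rewrite /local_monomial.
  case: ifP => [/andP[GC /asboolP Gx]|]; last by rewrite mulr0.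
  by move/eqP: GF; case; exact: disjC Gx Fx.
rewrite v0; last by move=> F FC Fx; apply: nF; exists F.
rewrite big1// => F _; apply: big1 => m _; rewrite /local_monomial.
by case: ifP => [/andP[FC /asboolP Fx]|]; [case: nF; exists F|rewrite mulr0].
Qed.

End Piecewise.

(** * The bilinear form on the mesh *)

Section Lebint_extra.
Context {R : realType} {n : nat}.
Hypothesis n_range : (0 < n < 4)%N.
Implicit Types (A : set 'rV[R]_n) (f g : 'rV[R]_n -> R).

Lemma lebintD A f g : open A -> bounded_set A -> cext A f -> cext A g ->
  lebint A (fun x => f x + g x) = lebint A f + lebint A g.
Proof.
move=> oA bA cf cg; rewrite -[lebint A f]mul1r -lebint_lin//.
by apply: eq_lebint => // x _; rewrite mul1r.
Qed.

Lemma lebintZ A f a : open A -> bounded_set A -> cext A f ->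
  lebint A (fun x => a * f x) = a * lebint A f.
Proof.
move=> oA bA cf.
have l0 : lebint A (fun=> 0) = 0.
  have := lebintD oA bA (cext_cst A 0) (cext_cst A 0).
  rewrite (@eq_lebint _ _ n_range A _ (fun=> 0)); last by move=> x _; rewrite addr0.
  move=> /eqP.
  by rewrite -subr_eq0 opprD addNKr oppr_eq0 => /eqP.
rewrite -[RHS]addr0 -[X in _ = _ + X]l0 -lebint_lin//; last exact: cext_cst.
by apply: eq_lebint => // x _; rewrite addr0.
Qed.

Lemma lebintB A f g : open A -> bounded_set A -> cext A f -> cext A g ->
  lebint A (fun x => f x - g x) = lebint A f - lebint A g.
Proof.
move=> oA bA cf cg; rewrite -[- lebint A g]mulN1r addrC -lebint_lin//.
by apply: eq_lebint => // x _; rewrite mulN1r addrC.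
Qed.

Lemma le_lebint A f g : open A -> bounded_set A -> cext A f -> cext A g ->
  (forall x, A x -> f x <= g x) -> lebint A f <= lebint A g.
Proof.
move=> oA bA cf cg fg; rewrite -subr_ge0 -lebintB//.
by apply: lebint_ge0 => // x Ax; rewrite subr_ge0 fg.
Qed.

Lemma norm_lebint_le A f c : open A -> bounded_set A -> cext A f ->
  (forall x, A x -> `|f x| <= c) -> `|lebint A f| <= c * lebint A (fun=> 1).
Proof.
move=> oA bA cf fc; have c1 := cext_cst A (1 : R).
have fcn x : A x -> - c * 1 <= f x <= c * 1.
  by move=> /fc; rewrite ler_norml !mulr1.
rewrite ler_norml -mulNr -!lebintZ//; apply/andP; split; apply: le_lebint => //;
  try exact: cext_cst; by move=> x /fcn/andP[].
Qed.

End Lebint_extra.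

(** * Traces and derivatives of functions known on a set *)

Section Traces.
Context {R : realType} {d : nat}.
Implicit Types (A : set 'rV[R]_d) (v g : 'rV[R]_d -> R).

(** The point lies in the closure of [A], so the filter defining the trace is proper and its limit
    is unique. *)
Lemma trace_from_eq A v g x : closure A x -> continuous g ->
  (forall y, A y -> v y = g y) -> trace_from A v x = g x.
Proof.
move=> Ax cg vg; apply/cvg_lim => //.
have FF : ProperFilter (within A (nbhs x)) by exact: within_nbhs_proper.
have cgA : g y @[y --> within A (nbhs x)] --> g x.
  exact: cvg_within_filter (cg x).
apply: cvg_trans cgA; apply: near_eq_cvg.
have FA : within A (nbhs x) A by exact: withinT.
by apply: filterS FA => y Ay; rewrite /= vg.
Qed.

Lemma partial_eq A v g i x : open A -> A x -> (forall y, A y -> v y = g y) ->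
  partial i v x = partial i g x.
Proof.
move=> oA Ax vg; apply: near_eq_derive.
have : \forall y \near x, A y by exact: open_nbhs_nbhs.
by apply: filterS => y /vg.
Qed.

End Traces.

Definition lincomb {R : realType} {d : nat} (a : R)
    (u v : ('rV[R]_d -> R) * ('rV[R]_d -> R)) :=
  ((fun x => a * u.1 x + v.1 x), (fun x => a * u.2 x + v.2 x)).

Section Mesh_forms.
Context {R : realType} {n k : nat} {T : mesh R n.+1}.
Variables (Omega : set 'rV[R]_n.+1).
Hypothesis n_range : (0 < n < 3)%N.
Hypothesis conf : conforming_mesh Omega T.
Implicit Types (K F : {set 'I_(nnodes T)}) (f g : 'rV[R]_n.+1 -> R).
Implicit Types u v w : ('rV[R]_n.+1 -> R) * ('rV[R]_n.+1 -> R).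

Let n_face : (0 < n < 4)%N.
Proof. by case/andP: n_range => -> /ltnW. Qed.

Let n_elt : (0 < n.+1 < 4)%N.
Proof. by case/andP: n_range. Qed.

Let elt_card K : K \in elts T -> #|K| = n.+2.
Proof. by case: conf => H _ _ _ /H[]. Qed.

Let elt_indep K : K \in elts T -> affinely_independent (@node R _ T) K.
Proof. by case: conf => H _ _ _ /H[]. Qed.

Lemma oelt_open K : K \in elts T -> open (oelt K).
Proof. by move=> KT; apply: osimplex_open; [exact: elt_card|exact: elt_indep]. Qed.

Lemma oelt_bounded K : bounded_set (oelt K).
Proof. exact: osimplex_bounded. Qed.

(** By conformity a common point lies in the simplex on [K :&: K'], which therefore contains both
    vertex sets. Both are then faces of the single simplex [K], where uniqueness of the coordinates
    gives the two inclusions. *)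
Lemma oelt_disjoint K K' F F' x : K \in elts T -> K' \in elts T ->
  F \subset K -> F' \subset K' -> oelt F x -> oelt F' x -> F = F'.
Proof.
move=> KT K'T FK F'K' Fx F'x.
have cKK' : celt (K :&: K')%SET x.
  case: conf => _ _ _ /(_ K K' KT K'T) <-.
  have sub (E E' : {set 'I_(nnodes T)}) : E \subset E' -> oelt E x -> celt E' x.
    move=> EE' [l [l0 l1 lx]].
    exists (fun i => if i \in E then l i else 0); split.
    - by move=> i _; case: ifP => // /l0/ltW.
    - by rewrite -sum_extend.
    - rewrite lx (sum_extend _ EE'); apply: eq_bigr => j _.
      by case: ifP; rewrite // scale0r.
  by split; [exact: sub FK Fx|exact: sub F'K' F'x].
have FKK' : F \subset K :&: K'.
  exact: osimplex_sub (elt_indep KT) FK (finset.subsetIl _ _) Fx cKK'.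
have F'KK' : F' \subset K :&: K'.
  exact: osimplex_sub (elt_indep K'T) F'K' (finset.subsetIr _ _) F'x cKK'.
have F'K : F' \subset K := fintype.subset_trans F'KK' (finset.subsetIl _ _).
apply/eqP; rewrite finset.eqEsubset.
by rewrite (osimplex_sub (elt_indep KT) FK F'K Fx (osimplexS F'x))
  (osimplex_sub (elt_indep KT) F'K FK F'x (osimplexS Fx)).
Qed.

Lemma elts_disjoint F G x : F \in elts T -> G \in elts T ->
  oelt F x -> oelt G x -> F = G.
Proof. by move=> FT GT; exact: oelt_disjoint FT GT (fintype.subxx _) (fintype.subxx _). Qed.

Lemma faces_disjoint F G x : F \in faces T -> G \in faces T ->
  oelt F x -> oelt G x -> F = G.
Proof.
rewrite !inE => /existsP[K /andP[KT]]; rewrite inE => /andP[FK _].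
move=> /existsP[K' /andP[K'T]]; rewrite inE => /andP[GK' _].
exact: oelt_disjoint KT K'T FK GK'.
Qed.

Section Element.
Variable K : {set 'I_(nnodes T)}.
Hypothesis KT : K \in elts T.
Let oK := oelt_open KT.
Let bK := @oelt_bounded K.

Lemma elt_facesP F : F \in elt_faces K ->
  [/\ F \in faces T, #|F| = n.+1, affinely_independent (@node R _ T) F
    & forall x, oelt F x -> closure (oelt K) x].
Proof.
move=> FK; have := FK; rewrite inE => /andP[FsK /eqP cF]; split => //.
- by rewrite inE; apply/existsP; exists K; rewrite KT.
- exact: affinely_independentS FsK (elt_indep KT).
- by move=> x /osimplexS; exact: closure_osimplex.
Qed.

(** One C1 function [p] represents [f] on the element together with its gradient and both traces, so
    that cutoffs and limits disappear from later computations. *)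
Lemma Sh_local f : Sh k T f -> exists p : 'rV[R]_n.+1 -> R, [/\ C1 p,
  forall x, oelt K x -> f x = p x,
  forall i x, oelt K x -> partial i f x = partial i p x,
  forall F x, F \in elt_faces K -> oelt F x -> trace_from (oelt K) f x = p x
  & forall i F x, F \in elt_faces K -> oelt F x ->
      trace_from (oelt K) (partial i f) x = partial i p x].
Proof.
move=> [/(_ K KT)[p pp fp] _]; have cp := polyfun_C1 pp.
have dfp i x : oelt K x -> partial i f x = partial i p x.
  by move=> Kx; exact: partial_eq oK Kx fp.
exists p; split => //.
- by move=> F x /elt_facesP[_ _ _ cF] /cF Kx; apply: trace_from_eq => //; case: cp.
- move=> i F x /elt_facesP[_ _ _ cF] /cF Kx; apply: trace_from_eq => //.
    by have [_ /(_ i)[]] := cp.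
  exact: dfp.
Qed.

Lemma Sh_cext f : Sh k T f -> cext (oelt K) f.
Proof. by move=> /Sh_local[p [[cp _] fp _ _ _]]; exists p. Qed.

Lemma graddot_cext f g : Sh k T f -> Sh k T g -> cext (oelt K) (graddot f g).
Proof.
move=> /Sh_local[p [[_ cp] _ fp _ _]] /Sh_local[q [[_ cq] _ gq _ _]].
exists (fun x => \sum_i partial i p x * partial i q x).
  apply: continuous_sum => i _; apply: continuous_mulr; [exact: (cp i).2|exact: (cq i).2].
by move=> x Kx; apply: eq_bigr => i _; rewrite fp// gq.
Qed.

Lemma graddot_lin a f g h x : Sh k T f -> Sh k T g -> oelt K x ->
  graddot (fun x => a * f x + g x) h x = a * graddot f h x + graddot g h x.
Proof.
move=> Sf Sg Kx; rewrite mulr_sumr -big_split /=; apply: eq_bigr => i _.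
have [p [[_ cp] fp dfp _ _]] := Sh_local Sf.
have [q [[_ cq] gq dgq _ _]] := Sh_local Sg.
have -> : partial i (fun x => a * f x + g x) x = partial i (fun x => a * p x + q x) x.
  by apply: partial_eq oK Kx _ => y Ky; rewrite fp// gq.
rewrite dfp// dgq// mulrA -mulrDl; congr (_ * _); rewrite /partial.
have -> : (fun x => a * p x + q x) = (a *: p : _ -> R^o) + q by [].
by rewrite deriveD ?deriveZ//; [exact: (cp i).1|apply: derivableZ; exact: (cp i).1|exact: (cq i).1].
Qed.

Section Face.
Variable F : {set 'I_(nnodes T)}.
Hypothesis FK : F \in elt_faces K.

Lemma hatSh_cext f : hatSh k T f -> cext (oelt F) f.
Proof.
have [FT _ _ _] := elt_facesP FK; move=> [/(_ F FT)[p /polyfun_C1[cp _] fp] _].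
by exists p.
Qed.

Lemma jump_cext v : bSh k T v -> cext (oelt F) (jump K v).
Proof.
move=> [/Sh_local[p [[cp _] _ _ tp _]] /hatSh_cext cv]; apply: cextB cv.
by exists p => // x; exact: tp.
Qed.

Lemma jump_lin a u v x : bSh k T u -> bSh k T v -> oelt F x ->
  jump K (lincomb a u v) x = a * jump K u x + jump K v x.
Proof.
move=> [/Sh_local[p [[cp _] up _ tp _]] _] [/Sh_local[q [[cq _] vq _ tq _]] _] Fx.
have [_ _ _ /(_ x Fx) Kx] := elt_facesP FK.
rewrite /jump (tp F)// (tq F)// (@trace_from_eq _ _ _ _ (fun x => a * p x + q x))//=.
- ring.
- by apply: continuous_addr => //; apply: continuous_mulr => //; exact: cst_continuous.
- by move=> y Ky; rewrite up// vq.
Qed.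

Lemma dnormal_cext v : bSh k T v -> cext (oelt F) (dnormal K F v).
Proof.
move=> [/Sh_local[p [[_ cp] _ _ _ tp]] _]; apply: cext_sum => i.
apply: cextM; last exact: cext_cst.
by exists (partial i p); [exact: (cp i).2|move=> x; exact: tp].
Qed.

Lemma dnormal_lin a u v x : bSh k T u -> bSh k T v -> oelt F x ->
  dnormal K F (lincomb a u v) x = a * dnormal K F u x + dnormal K F v x.
Proof.
move=> [/Sh_local[p [[_ cp] up _ _ tp]] _] [/Sh_local[q [[_ cq] vq _ _ tq]] _] Fx.
have [_ _ _ /(_ x Fx) Kx] := elt_facesP FK.
rewrite mulr_sumr -big_split /=; apply: eq_bigr => i _.
rewrite mulrA -mulrDl; congr (_ * _); rewrite (tp i F)// (tq i F)//.
apply: (@trace_from_eq _ _ _ _ (fun x => a * partial i p x + partial i q x)) => //.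
  apply: continuous_addr; last exact: (cq i).2.
  by apply: continuous_mulr; [exact: cst_continuous|exact: (cp i).2].
move=> y Ky.
have -> : partial i (fun x => a * u.1 x + v.1 x) y = partial i (fun x => a * p x + q x) y.
  by apply: partial_eq oK Ky _ => z Kz; rewrite up// vq.
rewrite /partial.
have -> : (fun x => a * p x + q x) = (a *: p : _ -> R^o) + q by [].
by rewrite deriveD ?deriveZ//; [exact: (cp i).1|apply: derivableZ; exact: (cp i).1|exact: (cq i).1].
Qed.

End Face.

Lemma bdint_lin a (g g1 g2 : {set 'I_(nnodes T)} -> 'rV[R]_n.+1 -> R) :
  (forall F x, F \in elt_faces K -> oelt F x -> g F x = a * g1 F x + g2 F x) ->
  (forall F, F \in elt_faces K -> cext (oelt F) (g1 F)) ->
  (forall F, F \in elt_faces K -> cext (oelt F) (g2 F)) ->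
  bdint K g = a * bdint K g1 + bdint K g2.
Proof.
move=> gE c1 c2; rewrite mulr_sumr -big_split /=; apply: eq_bigr => F FK.
have [_ cF iF _] := elt_facesP FK.
rewrite -surfint_lin//; [|exact: c1|exact: c2].
by apply: eq_surfint => // x Fx; exact: gE.
Qed.

Lemma bdint_ge0 (g : {set 'I_(nnodes T)} -> 'rV[R]_n.+1 -> R) :
  (forall F x, F \in elt_faces K -> oelt F x -> 0 <= g F x) -> 0 <= bdint K g.
Proof.
move=> g0; apply: sumr_ge0 => F FK; have [_ cF iF _] := elt_facesP FK.
by apply: surfint_ge0 => // x; exact: g0.
Qed.

Lemma bdint_eq0 (g : {set 'I_(nnodes T)} -> 'rV[R]_n.+1 -> R) :
  (forall F x, F \in elt_faces K -> oelt F x -> 0 <= g F x) ->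
  (forall F, F \in elt_faces K -> cext (oelt F) (g F)) ->
  bdint K g = 0 -> forall F x, F \in elt_faces K -> oelt F x -> g F x = 0.
Proof.
move=> g0 cg /eqP; rewrite psumr_eq0; last first.
  move=> F FK; have [_ cF iF _] := elt_facesP FK.
  by apply: surfint_ge0 => // x; exact: g0.
move=> /allP H F x FK; have [_ cF iF _] := elt_facesP FK.
have := H F (mem_index_enum _); rewrite FK /= => /eqP I0.
by apply: (surfint_eq0 n_face cF iF (cg F FK)) => // y; exact: g0.
Qed.

End Element.

End Mesh_forms.

(** * Linearity, symmetry and definiteness of the forms *)

Section Form_properties.
Context {R : realType} {n k : nat} {T : mesh R n.+1}.
Variables (Omega : set 'rV[R]_n.+1).
Hypothesis n_range : (0 < n < 3)%N.
Hypothesis conf : conforming_mesh Omega T.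
Implicit Types (K F : {set 'I_(nnodes T)}) (f g : 'rV[R]_n.+1 -> R).
Implicit Types u v w : ('rV[R]_n.+1 -> R) * ('rV[R]_n.+1 -> R).

Let n_elt : (0 < n.+1 < 4)%N.
Proof. by case/andP: n_range. Qed.

Definition elementwise_cext f : Prop := forall K, K \in elts T -> cext (oelt K) f.

Lemma Sh_elementwise f : Sh k T f -> elementwise_cext f.
Proof. by move=> Sf K KT; exact: (Sh_cext conf KT Sf). Qed.

Lemma elementwise_lin a f g : elementwise_cext f -> elementwise_cext g ->
  elementwise_cext (fun x => a * f x + g x).
Proof.
move=> ef eg K KT; apply: cextD (eg K KT); apply: cextM (ef K KT).
exact: cext_cst.
Qed.

Lemma Sh_lin a f g : Sh k T f -> Sh k T g -> Sh k T (fun x => a * f x + g x).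
Proof. exact: piecewise_poly_lin. Qed.

Lemma bSh_lin a u v : bSh k T u -> bSh k T v -> bSh k T (lincomb a u v).
Proof. by move=> [u1 u2] [v1 v2]; split; exact: piecewise_poly_lin. Qed.

(** [f] may be a nonlinear expression that is nonzero on the skeleton of the mesh; the product still
    vanishes there because the representative [g] does. *)
Lemma L2dotE f g : elementwise_cext f -> Sh k T g ->
  L2dot Omega f g = \sum_(K in elts T) lebint (oelt K) (fun x => f x * g x).
Proof.
move=> ef Sg; apply: lebint_partition => //.
- move=> K KT; split.
  + exact: (oelt_open conf KT).
  + exact: oelt_bounded.
  + by apply: cextM (Sh_elementwise Sg KT); exact: ef.
  + by case: conf => _ _ /(_ K KT).
- by move=> K L x; exact: (elts_disjoint conf).
- by move=> x Ox nK; have [_ ->] := Sg; rewrite ?mulr0.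
Qed.

Lemma L2dotC f g : L2dot Omega f g = L2dot Omega g f.
Proof. by congr lebint; apply/funext => x; rewrite mulrC. Qed.

Lemma L2dot_linl a f g h : elementwise_cext f -> elementwise_cext g -> Sh k T h ->
  L2dot Omega (fun x => a * f x + g x) h = a * L2dot Omega f h + L2dot Omega g h.
Proof.
move=> ef eg Sh'; rewrite !L2dotE//; last exact: elementwise_lin.
rewrite mulr_sumr -big_split /=; apply: eq_bigr => K KT.
have ch := Sh_elementwise Sh' KT.
rewrite -lebint_lin//; [|exact: (oelt_open conf KT)|exact: oelt_bounded|
  exact: cextM (ef K KT) ch|exact: cextM (eg K KT) ch].
by apply: eq_lebint => // x _; rewrite mulrDl mulrA.
Qed.

Lemma L2dot_linr a f g h : elementwise_cext f -> Sh k T g -> Sh k T h ->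
  L2dot Omega f (fun x => a * g x + h x) = a * L2dot Omega f g + L2dot Omega f h.
Proof.
move=> ef Sg Sh'; rewrite !L2dotE//; last exact: Sh_lin.
rewrite mulr_sumr -big_split /=; apply: eq_bigr => K KT.
have cf := ef K KT.
rewrite -lebint_lin//; [|exact: (oelt_open conf KT)|exact: oelt_bounded|
  exact: cextM cf (Sh_elementwise Sg KT)|exact: cextM cf (Sh_elementwise Sh' KT)].
by apply: eq_lebint => // x _; rewrite mulrDr mulrCA.
Qed.

Lemma L2dot_ge0 f : 0 <= L2dot Omega f f.
Proof. by apply: lebint_ge0 => // x _; rewrite -expr2 sqr_ge0. Qed.

Lemma L2dot_eq0 f : Sh k T f -> L2dot Omega f f = 0 -> f = fun=> 0.
Proof.
move=> Sf; have ef := Sh_elementwise Sf; rewrite L2dotE// => /eqP.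
rewrite psumr_eq0; last first.
  by move=> K KT; apply: lebint_ge0 => // x _; rewrite -expr2 sqr_ge0.
move=> /allP H; apply/funext => x.
have [[K [KT Kx]]|nK] := pselect (exists K, K \in elts T /\ oelt K x); last first.
  by case: Sf => _ ->// K KT Kx; apply: nK; exists K.
have := H K (mem_index_enum _); rewrite KT /= => /eqP I0.
have : f x * f x = 0.
  apply: (lebint_eq0 n_elt (oelt_open conf KT) (@oelt_bounded _ _ _ K)
    (cextM (ef K KT) (ef K KT)) _ I0 Kx).
  by move=> y _; rewrite -expr2 sqr_ge0.
by move=> /eqP; rewrite mulf_eq0 orbb => /eqP.
Qed.

Variable sigma : R.
Local Notation aD := (@aD R n.+1 T sigma).

Let volume_form u v := \sum_(K in elts T) lebint (oelt K) (graddot u.1 v.1).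
Let flux_form u v := \sum_(K in elts T) bdint K (fun F x =>
  dnormal K F u x * jump K v x + jump K u x * dnormal K F v x).
Let penalty_form u v := \sum_(K in elts T)
  sigma / hE K * bdint K (fun F x => jump K u x * jump K v x).

Let aDE u v : aD u v = volume_form u v - flux_form u v + penalty_form u v.
Proof. by []. Qed.

Lemma aD_sym u v : aD u v = aD v u.
Proof.
have volC : volume_form u v = volume_form v u.
  apply: eq_bigr => K _; rewrite (_ : graddot u.1 v.1 = graddot v.1 u.1)//.
  by apply/funext => x; apply: eq_bigr => i _; rewrite mulrC.
have fluxC : flux_form u v = flux_form v u.
  apply: eq_bigr => K _; apply: eq_bigr => F _.
  refine (congr1 (surfint (@node R n.+1 T) F) _); apply/funext => x.
  by rewrite addrC mulrC [X in _ + X]mulrC.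
have penC : penalty_form u v = penalty_form v u.
  apply: eq_bigr => K _.
  refine (congr1 (fun r => sigma / hE K * r) _); apply: eq_bigr => F _.
  refine (congr1 (surfint (@node R n.+1 T) F) _); apply/funext => x.
  by rewrite mulrC.
by rewrite !aDE volC fluxC penC.
Qed.

Lemma aD_linl a u v w : bSh k T u -> bSh k T v -> bSh k T w ->
  aD (lincomb a u v) w = a * aD u w + aD v w.
Proof.
move=> Su Sv Sw; rewrite !aDE.
have Vlin : volume_form (lincomb a u v) w = a * volume_form u w + volume_form v w.
  rewrite /volume_form mulr_sumr -big_split /=; apply: eq_bigr => K KT.
  have [[[Su1 _] [Sv1 _]] [Sw1 _]] := (Su, Sv, Sw).
  rewrite -lebint_lin//; [|exact: (oelt_open conf KT)|exact: oelt_bounded|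
    exact: (graddot_cext conf KT Su1 Sw1)|exact: (graddot_cext conf KT Sv1 Sw1)].
  by apply: eq_lebint => // x Kx; exact: (graddot_lin conf KT _ _ Su1 Sv1 Kx).
have alg (p q r s t z : R) :
    (a * p + q) * r + (a * s + t) * z = a * (p * r + s * z) + (q * r + t * z) by ring.
have Blin : flux_form (lincomb a u v) w = a * flux_form u w + flux_form v w.
  rewrite /flux_form mulr_sumr -big_split /=; apply: eq_bigr => K KT.
  apply: (bdint_lin n_range conf KT).
  - move=> F x FK Fx; rewrite (dnormal_lin conf KT FK _ Su Sv Fx).
    rewrite (jump_lin conf KT FK _ Su Sv Fx).
    exact: alg.
  - move=> F FK; apply: cextD; apply: cextM.
    + exact: (dnormal_cext conf KT FK Su).
    + exact: (jump_cext conf KT FK Sw).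
    + exact: (jump_cext conf KT FK Su).
    + exact: (dnormal_cext conf KT FK Sw).
  - move=> F FK; apply: cextD; apply: cextM.
    + exact: (dnormal_cext conf KT FK Sv).
    + exact: (jump_cext conf KT FK Sw).
    + exact: (jump_cext conf KT FK Sv).
    + exact: (dnormal_cext conf KT FK Sw).
have Jlin : penalty_form (lincomb a u v) w = a * penalty_form u w + penalty_form v w.
  rewrite /penalty_form mulr_sumr -big_split /=; apply: eq_bigr => K KT.
  rewrite mulrCA -mulrDr; congr (_ * _); apply: (bdint_lin n_range conf KT).
  - by move=> F x FK Fx; rewrite (jump_lin conf KT FK _ Su Sv Fx) mulrDl mulrA.
  - move=> F FK; apply: cextM; first exact: (jump_cext conf KT FK Su).
    exact: (jump_cext conf KT FK Sw).
  - move=> F FK; apply: cextM; first exact: (jump_cext conf KT FK Sv).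
    exact: (jump_cext conf KT FK Sw).
have alg' (p q r s t z : R) :
    a * p + q - (a * r + s) + (a * t + z) = a * (p - r + t) + (q - s + z) by ring.
by rewrite Vlin Blin Jlin; exact: alg'.
Qed.

Hypothesis hE_gt0 : forall K, K \in elts T -> 0 < hE K.
Variable Ccoer : R.
Hypothesis Ccoer_gt0 : 0 < Ccoer.
Hypothesis coercive : forall v, bSh k T v -> Ccoer * norm1h_sq T v <= aD v v.

Let volume_ge0 v : 0 <= \sum_(K in elts T) lebint (oelt K) (graddot v.1 v.1).
Proof.
apply: sumr_ge0 => K _; apply: lebint_ge0 => // x _.
by apply: sumr_ge0 => i _; rewrite -expr2 sqr_ge0.
Qed.

Let jumps_ge0 v K : K \in elts T ->
  0 <= (hE K)^-1 * bdint K (fun F x => jump K v x ^+ 2).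
Proof.
move=> KT; apply: mulr_ge0; first by rewrite invr_ge0 ltW// hE_gt0.
by apply: (bdint_ge0 n_range conf KT (g := fun F x => jump K v x ^+ 2)) => F x _ _; exact: sqr_ge0.
Qed.

Lemma aD_ge0 v : bSh k T v -> 0 <= aD v v.
Proof.
move=> Sv; apply: le_trans (coercive Sv).
apply: mulr_ge0; first exact: ltW.
apply: addr_ge0; first exact: volume_ge0.
by apply: sumr_ge0 => K KT; exact: jumps_ge0.
Qed.

(** The argument of [psd_ker] on functions: along [t w + v] the nonnegative form has no constant
    term, so its linear coefficient is zero. *)
Lemma aD_ker v w : bSh k T v -> bSh k T w -> aD v v = 0 -> aD v w = 0.
Proof.
move=> Sv Sw v0; apply: (@lin_quad_ge0 _ _ (aD w w)) => t.
have := aD_ge0 (bSh_lin t Sw Sv); rewrite aD_linl//; last exact: bSh_lin.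
rewrite ![aD _ (lincomb _ _ _)]aD_sym !aD_linl// v0 (aD_sym w v).
by move=> H; apply: (le_trans H); lra.
Qed.

Lemma aD_definite v : bSh k T v -> aD v v = 0 -> v.1 = (fun=> 0) ->
  v = (fun=> 0, fun=> 0).
Proof.
move=> Sv v0 v10; have [_ Sv2] := Sv.
have jump0 K F x : K \in elts T -> F \in elt_faces K -> oelt F x -> jump K v x = 0.
  move=> KT FK Fx.
  have : \sum_(K in elts T) (hE K)^-1 * bdint K (fun F x => jump K v x ^+ 2) = 0.
    apply: le_anti; apply/andP; split; last by apply: sumr_ge0 => K' K'T; exact: jumps_ge0.
    have := coercive Sv; rewrite v0 pmulr_rle0//; apply: le_trans.
    by rewrite lerDr.
  move=> /eqP; rewrite psumr_eq0 => [/allP J0|K' K'T]; last exact: jumps_ge0.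
  have := J0 K (mem_index_enum _); rewrite KT /= mulf_eq0 invr_eq0 gt_eqF ?hE_gt0//= => /eqP I0.
  apply/eqP; rewrite -sqrf_eq0; apply/eqP.
  apply: (bdint_eq0 n_range conf KT (g := fun F x => jump K v x ^+ 2) _ _ I0 FK Fx).
    by move=> *; exact: sqr_ge0.
  move=> F' F'K; have cj := jump_cext conf KT F'K Sv.
  exact: (cextM cj cj).
rewrite [LHS]surjective_pairing v10; congr pair; apply/funext => x.
have [[F [FT Fx]]|nF] := pselect (exists F, F \in faces T /\ oelt F x); last first.
  by case: Sv2 => _ ->// F FT Fx; apply: nF; exists F.
have := FT; rewrite inE => /existsP[K /andP[KT FK]].
have [_ _ _ /(_ x Fx) Kx] := elt_facesP conf KT FK.
have := jump0 K F x KT FK Fx; rewrite /jump v10.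
rewrite (@trace_from_eq _ _ _ _ (fun=> 0))//; last exact: cst_continuous.
by rewrite sub0r => /eqP; rewrite oppr_eq0 => /eqP.
Qed.

End Form_properties.

(** * Continuity of nonlinear integrals in the coefficients *)

Section Parametric_integral.
Context {R : realType} {n N : nat}.
Hypothesis n_range : (0 < n < 4)%N.
Variables (A : set 'rV[R]_n) (b : 'I_N -> 'rV[R]_n -> R).
Hypotheses (oA : open A) (bA : bounded_set A) (cb : forall i, cext A (b i)).
Variables (P q : 'rV[R]_n -> R).
Hypotheses (cP : cext A P) (cq : cext A q).
Variable f : R -> R.
Hypothesis C2f : C2 f.

Let comb (x : 'rV[R]_N) y := \sum_i x 0 i * b i y.

Let comb_cext x : cext A (comb x).
Proof. by apply: cext_sum => i; apply: cextM => //; exact: cext_cst. Qed.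

(** For [z] within distance 1 of [x] all values of [comb] stay in one bounded interval, on which
    [derive1 f] is Lipschitz with constant [L]. The term [P] cancels in the difference, leaving the
    Lipschitz constant [L * S * Q * I1], where [I1] is the volume of [A]. *)
Lemma parametric_lebint_continuous :
  continuous (fun x => lebint A (fun y => (derive1 f (comb x y) + P y) * q y)).
Proof.
have /fin_all_exists2[M M0 bM] : forall i, exists2 M, 0 <= M & forall y, A y -> `|b i y| <= M.
  by move=> i; apply: cext_bounded.
have [Q Q0 qQ] := cext_bounded bA cq.
pose S := \sum_i M i; have S0 : 0 <= S by apply: sumr_ge0.
have combS (x : 'rV[R]_N) y : A y -> `|comb x y| <= `|x| * S.
  move=> Ay; rewrite mulr_sumr (le_trans (ler_norm_sum _ _ _))// ler_sum// => i _.
  by rewrite normrM ler_pM ?norm_coord_le// bM.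
move=> x; have [L L0 fL] := C2_derive1_lipschitz ((`|x| + 1) * S) C2f.
pose I1 := lebint A (fun=> 1).
have I10 : 0 <= I1 by apply: lebint_ge0.
pose Cst := L * S * Q * I1; have C0 : 0 <= Cst by rewrite !mulr_ge0.
have lip (z : 'rV[R]_N) : `|x - z| <= 1 ->
    `|lebint A (fun y => (derive1 f (comb x y) + P y) * q y) -
      lebint A (fun y => (derive1 f (comb z y) + P y) * q y)| <= Cst * `|x - z|.
  move=> xz1.
  have zx : `|z| <= `|x| + 1.
    by rewrite -[z](subKr x) (le_trans (ler_normB _ _))// lerD2l.
  have cdf w : cext A (fun y => derive1 f (comb w y)).
    exact: cext_comp (C2_derive1_continuous C2f) (comb_cext w).
  have ci w : cext A (fun y => (derive1 f (comb w y) + P y) * q y).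
    by apply: cextM => //; exact: cextD.
  rewrite -lebintB//.
  have -> : Cst * `|x - z| = L * (`|x - z| * S) * Q * I1 by rewrite /Cst; ring.
  apply: norm_lebint_le => //; first exact: cextB.
  move=> y Ay; rewrite -mulrBl opprD addrACA subrr addr0 normrM.
  apply: ler_pM => //; last exact: qQ.
  apply: (le_trans (fL _ _ _ _)).
  - by rewrite (le_trans (combS x y Ay))// ler_wpM2r// lerDl.
  - by rewrite (le_trans (combS z y Ay))// ler_wpM2r.
  - apply: ler_wpM2l => //.
    have -> : comb x y - comb z y = comb (x - z) y.
      by rewrite -sumrB; apply: eq_bigr => i _; rewrite !mxE mulrBl.
    exact: combS.
have FF := nbhs_filter x; apply/cvgrPdist_lt => e e0.
have C1 : 0 < Cst + 1 by rewrite ltr_wpDl.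
have d0 : 0 < Num.min 1 (e / (Cst + 1)) by rewrite lt_min ltr01 divr_gt0.
have : \forall z \near x, `|x - z| < Num.min 1 (e / (Cst + 1)).
  exact: (@cvgr_dist_lt _ _ _ (nbhs x) FF id x cvg_id _ d0).
apply: filterS => z; rewrite lt_min ltr_pdivlMr// => /andP[z1 ze].
apply: (le_lt_trans (lip z (ltW z1))); apply: le_lt_trans ze.
by rewrite mulrC ler_wpM2l// lerDl.
Qed.

End Parametric_integral.

(** * Spanning family and Gram matrices *)

Section Degrees_of_freedom.
Context {R : realType} {n k : nat} {T : mesh R n.+1}.
Variables (Omega : set 'rV[R]_n.+1).
Hypothesis n_range : (0 < n < 3)%N.
Hypothesis conf : conforming_mesh Omega T.
Local Notation fpair := (('rV[R]_n.+1 -> R) * ('rV[R]_n.+1 -> R))%type.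

Definition combination (N : nat) (b : 'I_N -> fpair) (x : 'rV[R]_N) : fpair :=
  ((fun y => \sum_i x 0 i * (b i).1 y), (fun y => \sum_i x 0 i * (b i).2 y)).

Lemma piecewise_poly0 (C : {set {set 'I_(nnodes T)}}) : piecewise_poly k C (fun=> 0).
Proof.
split=> // F _; exists (fun=> 0) => //.
by apply/polyfun_span; exists (fun=> 0) => x; rewrite big1// => m' _; rewrite mul0r.
Qed.

(** Membership and the formula are proved together because [l] is linear only on the discrete space.
    Taking [l] to be zero extracts membership alone. *)
Lemma linear_combination N (b : 'I_N -> fpair) (l : fpair -> R) x :
  (forall i, bSh k T (b i)) ->
  (forall a u v, bSh k T u -> bSh k T v -> l (lincomb a u v) = a * l u + l v) ->
  bSh k T (combination b x) /\ l (combination b x) = \sum_i x 0 i * l (b i).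
Proof.
move=> Sb lin; rewrite /combination.
have S0 : bSh k T (fun=> 0, fun=> 0) by split; exact: piecewise_poly0.
elim: (index_enum _) => [|i r [IH1 IH2]].
  have -> : (fun y => \sum_(i <- [::]) x 0 i * (b i).1 y) = (fun=> 0).
    by apply/funext => y; rewrite big_nil.
  have -> : (fun y => \sum_(i <- [::]) x 0 i * (b i).2 y) = (fun=> 0).
    by apply/funext => y; rewrite big_nil.
  split => //; rewrite big_nil.
  have := lin 1 _ _ S0 S0.
  have -> : lincomb 1 (fun=> 0, fun=> 0) (fun=> 0, fun=> 0) = (fun=> 0, fun=> 0) :> fpair.
    by congr pair; apply/funext => y /=; rewrite mulr0 addr0.
  by rewrite mul1r => /eqP; rewrite -subr_eq0 opprD addNKr oppr_eq0 => /eqP.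
have -> : ((fun y => \sum_(i <- i :: r) x 0 i * (b i).1 y),
           (fun y => \sum_(i <- i :: r) x 0 i * (b i).2 y)) =
    lincomb (x 0 i) (b i) ((fun y => \sum_(i <- r) x 0 i * (b i).1 y),
           (fun y => \sum_(i <- r) x 0 i * (b i).2 y)).
  by congr pair; apply/funext => y /=; rewrite big_cons.
by split; [exact: bSh_lin|rewrite big_cons lin// IH2].
Qed.

Lemma gram_combination N (b : 'I_N -> fpair) (B : fpair -> fpair -> R) :
  (forall i, bSh k T (b i)) ->
  (forall a u v w, bSh k T u -> bSh k T v -> bSh k T w ->
     B (lincomb a u v) w = a * B u w + B v w) ->
  (forall u v, B u v = B v u) ->
  forall x y, edot (x *m \matrix_(i, j) B (b i) (b j)) y
    = B (combination b x) (combination b y).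
Proof.
move=> Sb lin sym x y.
have Bl z w : bSh k T w -> B (combination b z) w = \sum_i z 0 i * B (b i) w.
  by move=> Sw; apply: (linear_combination (l := B^~ w) z Sb _).2 => *; exact: lin.
have Sx : bSh k T (combination b x).
  by apply: (linear_combination (l := fun=> 0) x Sb _).1 => *; rewrite mulr0 addr0.
rewrite sym Bl//; apply: eq_bigr => j _.
rewrite sym Bl// !mxE mulrC; congr (_ * _).
by apply: eq_bigr => i _; rewrite mxE.
Qed.

Lemma bSh_span : exists (N : nat) (b : 'I_N -> fpair),
  (forall i, bSh k T (b i)) /\
  forall v, bSh k T v -> exists x, v = combination b x.
Proof.
pose D := ({set 'I_(nnodes T)} * mpoly.bmultinom n.+1 k.+1)%type.
pose bJ (j : D + D) : fpair := match j with
  | inl i => (local_monomial (elts T) i.1 i.2, fun=> 0)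
  | inr i => (fun=> 0, local_monomial (faces T) i.1 i.2) end.
have disjE := elts_disjoint conf; have disjF := faces_disjoint conf.
exists #|{: D + D}|, (fun i => bJ (enum_val i)); split.
  move=> i; case: (enum_val i) => j; split; rewrite /=.
  - exact: local_monomial_piecewise.
  - exact: piecewise_poly0.
  - exact: piecewise_poly0.
  - exact: local_monomial_piecewise.
move=> [v1 v2] [/= S1 S2].
have [a1 v1E] := piecewise_poly_span disjE S1.
have [a2 v2E] := piecewise_poly_span disjF S2.
pose a (j : D + D) := match j with inl i => a1 i | inr i => a2 i end.
exists (\row_i a (enum_val i)).
have sumJ (F : D + D -> R) :
    \sum_(i < #|{: D + D}|) (\row_i a (enum_val i)) 0 i * F (enum_val i) =
    \sum_i a1 i * F (inl i) + \sum_i a2 i * F (inr i).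
  under eq_bigr do rewrite mxE.
  by rewrite -(big_enum_val (fun j => a j * F j)) big_sumType.
congr pair; apply/funext => y /=.
  rewrite (sumJ (fun j => (bJ j).1 y)) [X in _ + X]big1 ?addr0//.
  by move=> i _; rewrite mulr0.
rewrite (sumJ (fun j => (bJ j).2 y)) [X in X + _]big1 ?add0r//.
by move=> i _; rewrite mulr0.
Qed.

End Degrees_of_freedom.

(** * The discrete scheme *)

Section Scheme.
Context {R : realType} {n k : nat} {T : mesh R n.+1}.
Variables (Omega : set 'rV[R]_n.+1).
Hypothesis n_range : (0 < n < 3)%N.
Hypothesis conf : conforming_mesh Omega T.
Hypothesis hE_gt0 : forall K, K \in elts T -> 0 < hE K.
Variables (sigma Ccoer kappa tau : R).
Hypothesis Ccoer_gt0 : 0 < Ccoer.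
Hypothesis coercive : forall v, bSh k T v -> Ccoer * norm1h_sq T v <= aD T sigma v v.
Hypotheses (kappa_gt0 : 0 < kappa) (tau_gt0 : 0 < tau).
Variables (f Q : R -> R).
Hypotheses (C2f : C2 f) (convf : convex_fun f) (contQ : continuous Q).
Variable cold : 'rV[R]_n.+1 -> R.
Hypothesis Scold : Sh k T cold.
Local Notation fpair := (('rV[R]_n.+1 -> R) * ('rV[R]_n.+1 -> R))%type.
Local Notation a := (@aD R n.+1 T sigma).
Local Notation L2 := (L2dot Omega).
Implicit Types (u v w c mu chi phi : fpair).

Let n_elt : (0 < n.+1 < 4)%N.
Proof. by case/andP: n_range. Qed.

Let ecell g : Sh k T g -> elementwise_cext (T := T) g.
Proof. exact: (Sh_elementwise conf). Qed.

(** [Q] stands for the derivative of the concave part. It is evaluated at the old state only, so it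
    is a fixed datum and the force is monotone in [g]. *)
Definition force (g : 'rV[R]_n.+1 -> R) : 'rV[R]_n.+1 -> R :=
  fun x => derive1 f (g x) + Q (cold x).

Let force_cext g : Sh k T g -> elementwise_cext (T := T) (force g).
Proof.
move=> Sg K KT; apply: cextD; apply: cext_comp => //; try exact: ecell KT.
exact: C2_derive1_continuous.
Qed.

Let L2_0l g : Sh k T g -> L2 (fun=> 0) g = 0.
Proof.
move=> Sg; rewrite (L2dotE n_range conf _ Sg); last by move=> K _; exact: cext_cst.
rewrite big1// => K KT; have := lebintZ n_elt 0 (oelt_open conf KT)
  (@oelt_bounded _ _ _ K) (cext_cst (oelt K) 0).
by rewrite !mul0r => E; rewrite -[RHS]E; apply: eq_lebint => // x _; rewrite mul0r.
Qed.

Let L2_sub g g' h : elementwise_cext (T := T) g -> elementwise_cext (T := T) g' ->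
  Sh k T h -> L2 (fun x => g x - g' x) h = L2 g h - L2 g' h.
Proof.
move=> eg eg' Sh'; rewrite -mulN1r [RHS]addrC.
rewrite -(L2dot_linl n_range conf _ eg' eg Sh'); congr lebint.
by apply/funext => x; rewrite mulN1r [X in X * _]addrC.
Qed.

Let L2_diffquot g h : elementwise_cext (T := T) g -> Sh k T h ->
  L2 (fun x => (g x - cold x) / tau) h = tau^-1 * (L2 g h - L2 cold h).
Proof.
move=> eg Sh'; have ec := ecell Scold.
rewrite -L2_sub// -[RHS]addr0 -[X in _ = _ + X](L2_0l Sh').
have ez : elementwise_cext (T := T) (fun=> 0) by move=> K _; exact: cext_cst.
have ed : elementwise_cext (T := T) (fun x => g x - cold x).
  by move=> K KT; apply: cextB; [exact: eg|exact: ec].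
rewrite -(L2dot_linl n_range conf _ ed ez Sh').
by congr lebint; apply/funext => x; rewrite addr0 (mulrC tau^-1).
Qed.

Lemma force_monotone c c' : Sh k T c.1 -> Sh k T c'.1 ->
  0 <= L2 (force c.1) (fun x => -1 * c'.1 x + c.1 x)
     - L2 (force c'.1) (fun x => -1 * c'.1 x + c.1 x).
Proof.
move=> Sc Sc'; have Sd := Sh_lin (-1) Sc' Sc.
rewrite -L2_sub//; [|exact: force_cext|exact: force_cext].
rewrite (L2dotE n_range conf _ Sd).
  apply: sumr_ge0 => K _; apply: lebint_ge0 => // x _.
  rewrite /force opprD addrACA subrr addr0 mulN1r [X in _ * X]addrC.
  by apply: convex_fun_derive1_mono => //; case: C2f.
by move=> K KT; apply: cextB; apply: force_cext.
Qed.

Definition solution (c mu : fpair) := [/\ bSh k T c, bSh k T mu,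
  forall chi, bSh k T chi -> L2 (fun x => (c.1 x - cold x) / tau) chi.1 + a mu chi = 0
  & forall phi, bSh k T phi -> L2 (force c.1) phi.1 + kappa * a c phi = L2 mu.1 phi.1].

Let lincomb_inj u v : lincomb (-1) v u = (fun=> 0, fun=> 0) -> u = v.
Proof.
move=> [E1 E2]; rewrite [LHS]surjective_pairing [RHS]surjective_pairing.
congr pair; apply/funext => x; apply/eqP; rewrite -subr_eq0 addrC -mulN1r; apply/eqP.
  exact: (congr1 (fun g => g x) E1).
exact: (congr1 (fun g => g x) E2).
Qed.

Lemma scheme_unique c mu c' mu' : solution c mu -> solution c' mu' ->
  (c, mu) = (c', mu').
Proof.
move=> [Sc Smu E1 E2] [Sc' Smu' E1' E2'].
pose dc := lincomb (-1) c' c; pose dm := lincomb (-1) mu' mu.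
have Sdc : bSh k T dc by exact: bSh_lin.
have Sdm : bSh k T dm by exact: bSh_lin.
have [[Sc1 _] [Sc1' _]] := (Sc, Sc'); have [[Sm1 _] [Sm1' _]] := (Smu, Smu').
have [Sdc1 _] := Sdc; have [Sdm1 _] := Sdm.
have D1 chi : bSh k T chi -> L2 dc.1 chi.1 = - (tau * a dm chi).
  move=> Schi; have [Schi1 _] := Schi.
  have clear_tau (x y p : R) : tau^-1 * (x - y) + p = 0 -> x = y - tau * p.
    move=> E; rewrite -[p](addKr (tau^-1 * (x - y))) E addr0 mulrN mulVKf ?gt_eqF//.
    by rewrite opprK addrC subrK.
  have := E1 _ Schi; have := E1' _ Schi.
  rewrite !L2_diffquot//; try exact: ecell.
  rewrite /dm (aD_linl n_range conf _ _ Smu' Smu Schi).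
  rewrite (L2dot_linl n_range conf _ (ecell Sc1') (ecell Sc1) Schi1).
  move=> /clear_tau -> /clear_tau ->.
  move: (L2 _ _) (a _ _) (a _ _) => x p q; ring.
have D2 phi : bSh k T phi -> L2 (force c.1) phi.1 - L2 (force c'.1) phi.1
    + kappa * a dc phi = L2 dm.1 phi.1.
  move=> Sphi; have [Sphi1 _] := Sphi.
  rewrite (L2dot_linl n_range conf _ (ecell Sm1') (ecell Sm1) Sphi1).
  rewrite -(E2 _ Sphi) -(E2' _ Sphi) /dc (aD_linl n_range conf _ _ Sc' Sc Sphi).
  move: (L2 _ _) (L2 _ _) (a _ _) (a _ _) => x y p q; ring.
have mono := force_monotone Sc1 Sc1'.
have pdc := aD_ge0 n_range conf hE_gt0 Ccoer_gt0 coercive Sdc.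
have pdm := aD_ge0 n_range conf hE_gt0 Ccoer_gt0 coercive Sdm.
have [adc0 adm0] : a dc dc = 0 /\ a dm dm = 0.
  have := D2 _ Sdc; rewrite (L2dotC _ dm.1) (D1 _ Sdm).
  have := mulr_ge0 (ltW kappa_gt0) pdc; have := mulr_ge0 (ltW tau_gt0) pdm.
  move: mono; rewrite -[fun x => -1 * c'.1 x + c.1 x]/(dc.1).
  move: (L2 (force c.1) dc.1) (L2 (force c'.1) dc.1) => x y h1 h2 h3 h4.
  have kz : kappa * a dc dc = 0 by lra.
  have tz : tau * a dm dm = 0 by lra.
  move/eqP: kz; move/eqP: tz; rewrite !mulf_eq0 (gt_eqF kappa_gt0) (gt_eqF tau_gt0).
  by move=> /= /eqP -> /eqP ->.
have dc1 : dc.1 = fun=> 0.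
  apply: (L2dot_eq0 n_range conf Sdc1); rewrite (D1 _ Sdc).
  by rewrite (aD_ker n_range conf hE_gt0 Ccoer_gt0 coercive Sdm Sdc adm0) mulr0 oppr0.
have dc0 := aD_definite n_range conf hE_gt0 Ccoer_gt0 coercive Sdc adc0 dc1.
have cc' : c = c' := lincomb_inj dc0.
have dm1 : dm.1 = fun=> 0.
  apply: (L2dot_eq0 n_range conf Sdm1); rewrite -(D2 _ Sdm) cc' subrr add0r.
  by rewrite (aD_ker n_range conf hE_gt0 Ccoer_gt0 coercive Sdc Sdm adc0) mulr0.
have dm0 := aD_definite n_range conf hE_gt0 Ccoer_gt0 coercive Sdm adm0 dm1.
by rewrite cc' (lincomb_inj dm0).
Qed.

Let L2_0r g : elementwise_cext (T := T) g -> L2 g (fun=> 0) = 0.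
Proof.
move=> eg; have S0 : Sh k T (fun=> 0) by exact: piecewise_poly0.
have := L2dot_linr n_range conf (-1) eg S0 S0.
by rewrite mulr0 addr0 mulN1r addNr.
Qed.

Lemma scheme_solvable : exists c mu, solution c mu.
Proof.
have [N [b [Sb span]]] := @bSh_span _ _ k _ _ conf.
pose C := combination b.
have SC x : bSh k T (C x).
  by apply: (linear_combination (l := fun=> 0) x Sb _).1 => *; rewrite mulr0 addr0.
have SC1 x : Sh k T (C x).1 by have [] := SC x.
pose m u v := L2 u.1 v.1.
pose A : 'M[R]_N := \matrix_(i, j) a (b i) (b j).
pose M : 'M[R]_N := \matrix_(i, j) m (b i) (b j).
have AE x y : edot (x *m A) y = a (C x) (C y).
  apply: gram_combination => //; last exact: aD_sym.
  by move=> t u v w Su Sv Sw; apply: (aD_linl n_range conf _ _ Su Sv Sw).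
have ME x y : edot (x *m M) y = m (C x) (C y).
  apply: gram_combination => // [t u v w [Su _] [Sv _] [Sw _]|u v]; last exact: L2dotC.
  exact: (L2dot_linl n_range conf _ (ecell Su) (ecell Sv) Sw).
pose g x : 'rV[R]_N := \row_i L2 (force (C x).1) (b i).1.
have gE x z : edot z (g x) = L2 (force (C x).1) (C z).1.
  rewrite (linear_combination (l := fun v => L2 (force (C x).1) v.1) z Sb _).2.
    by apply: eq_bigr => i _; rewrite mxE.
  move=> t u v [Su _] [Sv _].
  exact: (L2dot_linr n_range conf _ (force_cext (SC1 x)) Su Sv).
(* The derivative of this density in the value of [C x] is the force. The energy [G] sums over open
   elements because [f 0] need not be zero, so [E x] may be nonzero on the skeleton. *)
pose E x y := f ((C x).1 y) + Q (cold y) * (C x).1 y.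
pose G x := \sum_(K in elts T) lebint (oelt K) (E x).
have EC K x : K \in elts T -> cext (oelt K) (E x).
  move=> KT; apply: cextD.
    by apply: cext_comp; [exact: C2_continuous|exact: ecell].
  by apply: cextM; [apply: cext_comp => //; exact: ecell|exact: ecell].
(* The old state has no face part; zero is a harmless choice because [c0] enters the system only
   through [M], which sees volume parts. *)
have [c0 c0E] : exists c0 : 'rV_N, (cold, fun=> 0) = C c0.
  by apply: span; split => //; exact: piecewise_poly0.
have [|||||||c [mu [eq1 eq2]]] := @degenerate_convex_system_solvable R N A M
  tau kappa c0 G g tau_gt0 kappa_gt0.
- by apply/matrixP => i j; rewrite !mxE aD_sym.
- by apply/matrixP => i j; rewrite !mxE /m L2dotC.
- by move=> x; rewrite AE (aD_ge0 n_range conf hE_gt0 Ccoer_gt0 coercive).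
- by move=> x; rewrite ME; exact: L2dot_ge0.
(* A combination of zero mass has zero volume part, and the force is paired with the volume part
   only. This covers redundancies of the spanning family. *)
- move=> z _; rewrite ME => zM x; rewrite gE (L2dot_eq0 n_range conf (SC1 z) zM).
  by apply: L2_0r; exact: force_cext.
- move=> x y; rewrite gE (L2dotE n_range conf (force_cext (SC1 y)) (SC1 _)) -big_split.
  apply: ler_sum => K KT; have oK := oelt_open conf KT.
  have bK := @oelt_bounded _ _ _ K.
  have cF : cext (oelt K) (fun t => force (C y).1 t * (C (x - y)).1 t).
    by apply: cextM; [exact: force_cext|exact: ecell].
  rewrite [leLHS](_ : _ = lebint (oelt K) (E y) +
    lebint (oelt K) (fun t => force (C y).1 t * (C (x - y)).1 t))//.
  rewrite -lebintD//; last exact: EC.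
  apply: le_lebint => //; [apply: cextD => //|exact: EC|move=> t _]; first exact: EC.
  have -> : (C (x - y)).1 t = (C x).1 t - (C y).1 t.
    by rewrite -sumrB; apply: eq_bigr => i _; rewrite !mxE mulrBl.
  have [df _ _] := C2f.
  have := convex_fun_ge_tangent ((C x).1 t) convf (df ((C y).1 t)).
  by rewrite /E /force; lra.
- apply: rV_continuous => i.
  have -> : (fun x => g x 0 i) = fun x => \sum_(K in elts T)
      lebint (oelt K) (fun y => force (C x).1 y * (b i).1 y).
    apply/funext => x; have [Si _] := Sb i.
    by rewrite mxE (L2dotE n_range conf (force_cext (SC1 x)) Si).
  apply: continuous_sum => K KT.
  have cb j : cext (oelt K) (b j).1 by have [Sj _] := Sb j; exact: ecell.
  apply: (parametric_lebint_continuous n_elt (oelt_open conf KT) (@oelt_bounded _ _ _ K)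
    cb _ (cb i) C2f).
  by apply: cext_comp => //; exact: ecell.
exists (C c), (C mu); split => //.
  move=> chi /span[z ->]; rewrite L2_diffquot//; last exact: ecell.
  have : edot ((c - c0) *m M + tau *: (mu *m A)) z = 0 by rewrite eq1 edot0l.
  rewrite edotDl edotZl mulmxBl edotDl edotNl !ME AE /m -c0E /=.
  move=> h; apply: (mulfI (lt0r_neq0 tau_gt0)).
  by rewrite mulr0 mulrDr mulVKf ?gt_eqF.
move=> phi /span[z ->].
have := congr1 (fun y : 'rV_N => edot z y) eq2.
by rewrite edotDr edotZr gE !(edotC z) AE ME.
Qed.

Lemma scheme_wellposed : exists! cmu, solution cmu.1 cmu.2.
Proof.
have [c [mu sol]] := scheme_solvable; exists (c, mu); split => // -[c' mu'].
exact: scheme_unique.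
Qed.

End Scheme.

Theorem theorem1 (R : realType) (d : nat) (hd : d = 2%N \/ d = 3%N)
  (Omega : set 'rV[R]_d) (hOmega : polyhedral_domain Omega)
  (H : set R) (T : R -> mesh R d)
  (hH : forall h, H h -> 0 < h)
  (hT : forall h, H h -> conforming_mesh Omega (T h))
  (hsize : forall h, H h -> meshsize (T h) = h)
  (hreg : shape_regular H T) (hqu : quasi_uniform H T)
  (k : nat) (hk : (1 <= k)%N)
  (kappa : R) (hkappa : 0 < kappa)
  (sigma : R) (hsigma : 0 < sigma)
  (Ccoer : R) (hCcoer : 0 < Ccoer)
  (hcoer : forall h, H h -> forall v, bSh k (T h) v ->
    Ccoer * norm1h_sq (T h) v <= aD (T h) sigma v v)
  (Phi Phip Phim : R -> R) (hPhi : forall s, Phi s = Phip s + Phim s)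
  (hPhip : C2 Phip) (hPhip_convex : convex_fun Phip)
  (hPhim : C2 Phim) (hPhim_concave : concave_fun Phim)
  (h : R) (hh : H h) (tau : R) (htau : 0 < tau)
  (cold : 'rV[R]_d -> R) (hcold : Sh k (T h) cold) :
  exists! cmu : (('rV[R]_d -> R) * ('rV[R]_d -> R)) *
                (('rV[R]_d -> R) * ('rV[R]_d -> R)),
    let c := cmu.1 in let mu := cmu.2 in
    [/\ bSh k (T h) c,
        bSh k (T h) mu,
        forall chi, bSh k (T h) chi ->
          L2dot Omega (fun x => (c.1 x - cold x) / tau) chi.1
          + aD (T h) sigma mu chi = 0
      & forall phi, bSh k (T h) phi ->
          L2dot Omega
            (fun x => derive1 Phip (c.1 x) + derive1 Phim (cold x)) phi.1
          + kappa * aD (T h) sigma c phi = L2dot Omega mu.1 phi.1].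
Proof.
(* Quasi-uniformity bounds the mesh size [h > 0] by a multiple of every element diameter, so no
   diameter is zero. *)
have hE_gt0 K : K \in elts (T h) -> 0 < hE K.
  move=> KT; have [C C0 /(_ h hh K KT)] := hqu.
  rewrite hsize// => /(lt_le_trans (hH h hh)); by rewrite pmulr_rgt0.
have contQ : continuous (derive1 Phim) by exact: C2_derive1_continuous.
have coer := hcoer h hh.
by case: hd => dE; subst d; [apply: (scheme_wellposed (n := 1) isT (hT h hh) hE_gt0
    hCcoer coer hkappa htau hPhip hPhip_convex contQ hcold)
  |apply: (scheme_wellposed (n := 2) isT (hT h hh) hE_gt0
    hCcoer coer hkappa htau hPhip hPhip_convex contQ hcold)].
Qed.
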